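(* Let $N_0,N_1,N_2$ be the Poisson processes and $\{Y_{ki}\}$ the claim sizes described in the context, and let $$S_1(t)=\sum_{i=0}^{N_1(t)}Y_{1i}+\sum_{i=0}^{N_0(t)}Y_{3i},\qquad S_2(t)=\sum_{i=0}^{N_2(t)}Y_{2i}+\sum_{i=0}^{N_0(t)}Y_{4i},\qquad t\ge0.$$ Then the bivariate total claim amount process $(S_1,S_2)$ is a bivariate compound Poisson process of type I. It is stochastically equivalent (in the sense of finite dimensional distributions) to the process $(S_3,S_4)$, where $$S_3(t)=\sum_{n=0}^{N(t)}(I_{1n}Y_{1n}+I_{0n}Y_{3n}),\qquad S_4(t)=\sum_{n=0}^{N(t)}(I_{2n}Y_{2n}+I_{0n}Y_{4n}),\qquad t\ge0.$$ Here $Y_{k0}=0$ for $k=1,2,3,4$ and $I_{10}=I_{20}=I_{00}=0$; $N$ is a homogeneous Poisson process with $N(0)=0$ and parameter $\lambda=\lambda_1+\lambda_2+\lambda_0$; the random vectors $(I_{1i},I_{2i},I_{0i})$, $i=1,2,\dots$, are i.i.d. with $$\mathbb{P}(I_{11}=1,I_{21}=0,I_{01}=0)=\frac{\lambda_1}{\lambda},\quad \mathbb{P}(I_{11}=0,I_{21}=1,I_{01}=0)=\frac{\lambda_2}{\lambda},\quad \mathbb{P}(I_{11}=0,I_{21}=0,I_{01}=1)=\frac{\lambda_0}{\lambda};$$ and the random process $N$ and the sequences $\{Y_{1i}\}_{i=1}^\infty$, $\{Y_{2i}\}_{i=1}^\infty$, $\{(Y_{3i},Y_{4i})\}_{i=1}^\infty$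 and $\{(I_{1i},I_{2i},I_{0i})\}_{i=1}^\infty$ are mutually independent.
   Context: $N_0,N_1,N_2$ are mutually independent homogeneous Poisson processes with parameters $\lambda_0>0$, $\lambda_1>0$, $\lambda_2>0$ respectively, and $N_0(0)=N_1(0)=N_2(0)=0$. $Y_{k0}=0$ for $k=1,2,3,4$. For any fixed $k=1,2,3,4$ the random variables $Y_{k1},Y_{k2},\dots$ are independent and identically distributed, and almost surely strictly positive. The sequences $\{Y_{ki}\}_{i=1}^\infty$ and $\{N_r(s),s\ge0\}$, $k=1,2,3,4$, $r=0,1,2$, are mutually independent. The sequences $\{Y_{1i}\}_{i=1}^\infty$, $\{Y_{2i}\}_{i=1}^\infty$ and $\{(Y_{3i},Y_{4i})\}_{i=1}^\infty$ are mutually independent. The processes $S_1$ and $S_2$ are in general dependent. A bivariate compound Poisson process is said to be of type I if it is ''with equal number of summands'', i.e. it has the same finite dimensional distributions as $\left(\sum_{n=1}^{N(t)}U_n,\sum_{n=1}^{N(t)}V_n\right)$, $t\ge0$, where $N$ is a homogeneous Poisson process started at $0$ and $(U_n,V_n)$, $n\ge1$, are i.i.d. random vectors independent of $N$. *)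

(* Defs.v *)
From mathcomp Require Import all_boot all_order all_algebra finmap.
From mathcomp Require Import all_classical all_reals all_analysis.

Set Implicit Arguments.
Unset Strict Implicit.
Unset Printing Implicit Defensive.

Import Order.TTheory GRing.Theory Num.Theory.
Import numFieldNormedType.Exports.

Local Open Scope classical_set_scope.
Local Open Scope ring_scope.

Definition mutually_independent (R : realType) (d : measure_display)
    (T : measurableType d) (P : probability T R) (I : choiceType)
    (F : I -> set (set T)) : Prop :=
  forall (J : {fset I}) (E : I -> set T),
    (forall i, i \in J -> F i (E i)) ->
    P (\bigcap_(i in [set` J]) E i) = (\prod_(i <- J) P (E i))%E.

Definition sigma_rv (d d' : measure_display) (T : measurableType d)
    (T' : measurableType d') (X : T -> T') : set (set T) :=
  preimage_set_system setT X measurable.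

(* The sigma-algebra generated by all the X k, k in D, jointly. *)
Definition sigma_family (d d' : measure_display) (T : measurableType d)
    (T' : measurableType d') (K : Type) (D : set K) (X : K -> T -> T') :
    set (set T) :=
  <<s \bigcup_(k in D) sigma_rv (X k) >>.

Definition independent_list (R : realType) (d : measure_display)
    (T : measurableType d) (P : probability T R) (s : seq (set (set T))) : Prop :=
  mutually_independent P (fun i : 'I_(size s) => tnth (in_tuple s) i).

Definition same_law (R : realType) (d1 d2 d' : measure_display)
    (T1 : measurableType d1) (T2 : measurableType d2) (T' : measurableType d')
    (P1 : probability T1 R) (X1 : T1 -> T')
    (P2 : probability T2 R) (X2 : T2 -> T') : Prop :=
  forall A : set T', measurable A -> P1 (X1 @^-1` A) = P2 (X2 @^-1` A).

Definition iid (R : realType) (d d' : measure_display) (T : measurableType d)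
    (T' : measurableType d') (P : probability T R) (X : nat -> T -> T') : Prop :=
  [/\ forall n, measurable_fun setT (X n),
      mutually_independent P (fun n => sigma_rv (X n)) &
      forall n, same_law P (X n) P (X 0%N)].

Notation times := [set t | 0 <= t].
Notation positive_indices := [set i : nat | (0 < i)%N].

(* The values of N at negative times are irrelevant. The truncated subtraction
   in the increments is harmless, since paths are a.s. nondecreasing. *)
Record poisson_process (R : realType) (d : measure_display)
    (T : measurableType d) (P : probability T R) (lambda : R)
    (N : R -> T -> nat) : Prop := PoissonProcess {
  poisson_process_measurable :
    forall t, 0 <= t -> measurable_fun setT (N t);
  poisson_process_path :
    {ae P, forall w,
      [/\ N 0 w = 0%N,
          forall s t, 0 <= s -> s <= t -> (N s w <= N t w)%N &
          forall t, 0 <= t ->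
            (N s w)%:R @[s --> t^'+] --> ((N t w)%:R : R)]};
  poisson_process_independent_increments :
    forall t : nat -> R, 0 <= t 0%N -> {homo t : i j / (i <= j)%N >-> i <= j} ->
      mutually_independent P
        (fun i : nat => sigma_rv (fun w => (N (t i.+1) w - N (t i) w)%N));
  poisson_process_increment_law :
    forall s t, 0 <= s -> s < t -> forall k : nat,
      P [set w | (N t w - N s w)%N = k] =
      (poisson_pmf (lambda * (t - s)) k)%:E
}.

(* Equality of the finite dimensional distributions over [0, +oo[ of two
   bivariate processes, possibly on different probability spaces. *)
Definition fdd_equal (R : realType) (d1 d2 : measure_display)
    (T1 : measurableType d1) (T2 : measurableType d2)
    (P1 : probability T1 R) (X1 : R -> T1 -> R * R)
    (P2 : probability T2 R) (X2 : R -> T2 -> R * R) : Prop :=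
  forall (n : nat) (t : n.-tuple R), (forall i, 0 <= tnth t i) ->
    same_law P1 (fun w => [tuple X1 (tnth t i) w | i < n])
             P2 (fun w => [tuple X2 (tnth t i) w | i < n]).

Definition compound_poisson_type1 (R : realType) (d : measure_display)
    (T : measurableType d) (P : probability T R) (X : R -> T -> R * R) : Prop :=
  exists (d' : measure_display) (T' : measurableType d')
         (P' : probability T' R) (lambda : R) (N : R -> T' -> nat)
         (U V : nat -> T' -> R),
    [/\ 0 < lambda,
        poisson_process P' lambda N,
        iid P' (fun n w => (U n.+1 w, V n.+1 w)),
        independent_list P'
          [:: sigma_family times N;
              sigma_family positive_indices (fun n w => (U n w, V n w))] &
        fdd_equal P X P'
          (fun t w => (\sum_(1 <= n < (N t w).+1) U n w,
                       \sum_(1 <= n < (N t w).+1) V n w))].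

(* The dependence between Y3 i and Y4 i, for the same i, is arbitrary. *)
Record claim_sizes (R : realType) (d : measure_display)
    (T : measurableType d) (P : probability T R)
    (Y1 Y2 Y3 Y4 : nat -> T -> R) : Prop := ClaimSizes {
  claim_sizes_0 : forall w,
    [/\ Y1 0%N w = 0, Y2 0%N w = 0, Y3 0%N w = 0 & Y4 0%N w = 0];
  claim_sizes_iid1 : iid P (fun i => Y1 i.+1);
  claim_sizes_iid2 : iid P (fun i => Y2 i.+1);
  claim_sizes_iid34 : iid P (fun i w => (Y3 i.+1 w, Y4 i.+1 w));
  claim_sizes_gt0 : forall i, (0 < i)%N ->
    {ae P, forall w, [/\ 0 < Y1 i w, 0 < Y2 i w, 0 < Y3 i w & 0 < Y4 i w]}
}.

(* Main.v *)
Require Import Defs.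
From mathcomp Require Import all_boot all_order all_algebra finmap.
From mathcomp Require Import all_classical all_reals all_analysis.
From mathcomp Require Import measurable_realfun.
From mathcomp Require Import ring.

Import Order.TTheory GRing.Theory Num.Theory.
Import numFieldNormedType.Exports.

(** The process [(S1, S2)] is the sum over three types of shocks of compound
    Poisson processes with claims [(Y1, 0)], [(0, Y2)] and [(Y3, Y4)], driven by
    [N1], [N2] and [N0]. The theorem says that such a superposition can be read
    as one Poisson process with rate [Lambda = \sum_a lambda_a], whose points
    carry i.i.d. types drawn with probabilities [lambda_a / Lambda], each point
    bringing a claim of its type.

    Instead of ordering the points of the superposed processes in time, the
    proof compares laws ([superposition_fdd_thinning], for any finite set of
    types). Fix times [0 = tau_0 <= ... <= tau_n] with steps [h_j], and record
    for every interval [j] and type [a] the number [v_j(a)] of claims of type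
    [a] that fall in interval [j]. On the event that these counts are given,
    both processes at the times [tau] are the same sums of [v_0(a) + v_1(a) +
    ...] claims of type [a]. Everything reduces to two points.

    - Given the counts, the claims entering the sums are independent with the
      prescribed laws. For the superposition this is the assumed independence
      ([superposition_law]). For the marked process one fixes moreover the word
      of the types of the successive points; the claim attached to the [l]-th
      point of type [a] then sits at the position of the [l]-th letter [a] of
      the word, and this renumbering is injective ([occ_inj]), so it does not
      change the law of an i.i.d. family ([thinning_law]).

    - The counts have the same law on both sides. The superposition gives
      [\prod_j \prod_a Poisson(lambda_a h_j)(v_j(a))]. The marked process gives
      the product over [j] of [Poisson(Lambda h_j)(|v_j|)] times the probability
      that a word of [|v_j|] independent types has [v_j] as its vector of
      letter counts, by the multinomial theorem in blocks
      ([sum_type_weight_blocks]). The two agree factor by factor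
      ([poisson_weight_split]).

    The second half of the theorem follows, since the indicator vector is
    almost surely one of the three unit vectors and then names a type.

    For the first half a process of type I has to be exhibited. A marked process
    has this form ([compound_poisson_marked]): the claims picked by the marks are
    i.i.d. and independent of the driving process. A probability space which
    carries such a marked process is the given one. Only laws matter, so the
    sample paths of [N0], [N1], [N2] may be put to a new use: [N0] with its time
    rescaled is a Poisson process with rate [Lambda], and independent events of
    prescribed probability, from which the marks are made, are that [N1] or [N2]
    has no point in a cell of a regular grid ([increment_mark_law],
    [increment_mark_independent]).

    The hypotheses speak of the sigma-algebras generated by whole sequences and
    processes. Passing to single increments and claims, and back to groups of
    them, is the purpose of the general facts on independence
    ([mutually_independent_sequences], [mutually_independent_group]). *)

Local Open Scope classical_set_scope.
Local Open Scope ring_scope.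

Set Implicit Arguments.
Unset Strict Implicit.
Unset Printing Implicit Defensive.

(** * Independent families of sigma-algebras *)

Section Independence.
Context (R : realType) (d : measure_display) (T : measurableType d).
Variable P : probability T R.
Implicit Types (A B : set T) (G : set (set T)).

(** The sets [B] independent of [A] form a Dynkin class: two finite measures,
    [P (. `&` A)] and the multiple of [P] by [P A], agree on the pi-system [G],
    hence on what it generates. *)
Lemma independent_event_sigma A G : measurable A -> G `<=` measurable ->
  setI_closed G -> G setT ->
  (forall B, G B -> P (B `&` A) = (P B * P A)%E) ->
  forall B, <<s G >> B -> P (B `&` A) = (P B * P A)%E.
Proof.
move=> mA mG GI GT GA B sB.
pose pA : {nonneg R} := NngNum (fine_ge0 (measure_ge0 P A)).
have pAE : (pA%:num%:E = P A)%E by rewrite /= fineK// fin_num_measure.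
suff -> : P (B `&` A) = mscale pA P B by rewrite /mscale pAE muleC.
apply: (@g_sigma_algebra_measure_unique _ _ _ G mG (fun=> setT) _ _
  (mrestr P mA) (mscale pA P)) => //.
- by rewrite bigcup_const.
- by move=> C GC; rewrite /= /mscale pAE muleC -GA.
- by move=> _; rewrite (le_lt_trans (probability_le1 _ _)) ?ltry//; exact: measurableI.
Qed.

(** Only finitely many indices matter for a given event, so the pi-systems are
    replaced by their sigma-algebras one index at a time: at each step
    [independent_event_sigma] is applied to the intersection [A] of the events
    of the other indices. *)
Lemma mutually_independent_sigma (I : choiceType) (F : I -> set (set T)) :
  (forall i, F i `<=` measurable) -> (forall i, setI_closed (F i)) ->
  (forall i, F i setT) ->
  mutually_independent P F -> mutually_independent P (fun i => <<s F i >>).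
Proof.
move=> mF FI FT indF.
have msF i A : <<s F i >> A -> measurable A.
  by apply: smallest_sub; [exact: sigma_algebra_measurable|exact: mF].
suff H (s : seq I) : mutually_independent P
    (fun i => if i \in s then <<s F i >> else F i).
  move=> J E JE; apply: (H (enum_fset J)) => i iJ.
  by rewrite ifT//; exact: JE.
elim: s => [|i0 s IH]; first exact: indF.
move=> J E JE.
have [i0s|i0s] := boolP (i0 \in s).
  apply: IH => i iJ; move: (JE i iJ); rewrite inE.
  by case: eqP => // ->; rewrite i0s.
have [i0J|i0J] := boolP (i0 \in J); last first.
  apply: IH => i iJ; move: (JE i iJ); rewrite inE.
  by case: eqP => // ii0; move: i0J; rewrite -ii0 iJ.
rewrite (big_fsetD1 i0)//= bigcap_fset (big_fsetD1 i0)//= -bigcap_fset.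
set A := (X in _ `&` X).
have IHJ' : P A = (\prod_(i <- (J `\ i0)%fset) P (E i))%E.
  apply: IH => i /[!inE] /andP[ii0 iJ]; move: (JE i iJ); rewrite inE.
  by rewrite (negbTE ii0).
rewrite -IHJ'.
have mA : measurable A.
  apply: fin_bigcap_measurable => // i /= /[!inE] /andP[_ iJ].
  by have := JE i iJ; case: ifP => _ /=; [exact: msF|exact: mF].
apply: (independent_event_sigma mA (mF i0) (FI i0) (FT i0)); last first.
  by move: (JE _ i0J); rewrite mem_head.
move=> B FB.
(* The same family of events, with the event at i0 taken in the pi-system. *)
pose E' i := if i == i0 then B else E i.
have AE' : A = \bigcap_(i in [set` (J `\ i0)%fset]) E' i.
  apply: eq_bigcapr => i /=; rewrite !inE => /andP[].
  by rewrite /E' => /negbTE ->.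
have prE' : (\prod_(i <- (J `\ i0)%fset) P (E i) =
    \prod_(i <- (J `\ i0)%fset) P (E' i))%E.
  by apply: eq_fbigr => i /[!inE] /andP[/negbTE ii0 _] _; rewrite /E' ii0.
rewrite IHJ' prE' AE' bigcap_fset.
rewrite [in RHS](_ : B = E' i0); last by rewrite /E' eqxx.
rewrite [in LHS](_ : B = E' i0); last by rewrite /E' eqxx.
have := IH J E'; rewrite bigcap_fset !(big_fsetD1 i0 i0J)/=; apply => i iJ.
rewrite /E'; case: eqP => [->|ii0]; first by rewrite (negbTE i0s).
by have := JE i iJ; rewrite inE; case: eqP ii0.
Qed.

Lemma mutually_independentS (I : choiceType) (F G : I -> set (set T)) :
  (forall i, F i `<=` G i) ->
  mutually_independent P G -> mutually_independent P F.
Proof. by move=> FG indG J E JE; apply: indG => i iJ; exact/FG/JE. Qed.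

Lemma mutually_independent_inj (I K : choiceType) (h : K -> I)
    (F : I -> set (set T)) : injective h ->
  mutually_independent P F -> mutually_independent P (fun k => F (h k)).
Proof.
move=> hI indF J E JE.
have [->|[k0 k0J]] := fset_0Vmem J.
  by rewrite bigcap_fset !big_seq_fset0 probability_setT.
(* A left inverse of h on J, to transport the events. *)
pose g i := xget k0 [set k | k \in J /\ h k = i].
have gK k : k \in J -> g (h k) = k.
  by move=> kJ; rewrite /g; case: xgetP => [k' _ [_ /hI]//|/(_ k)]; case.
have := indF [fset h k | k in J]%fset (E \o g); rewrite bigcap_fset.
rewrite !big_imfset/=; try by move=> ? ? _ _ /hI.
have -> : \big[setI/setT]_(i <- J) E (g (h i)) = \bigcap_(i in [set` J]) E i.
  by rewrite bigcap_fset; apply: eq_fbigr => i iJ _; rewrite gK.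
move=> ->; first by apply: eq_fbigr => i iJ _; rewrite gK.
by move=> _ /imfsetP[k/= kJ ->]; rewrite gK//; exact: JE.
Qed.

(** Disjoint blocks [g @^-1` [set k]] of an independent family generate
    independent sigma-algebras: the finite intersections of events of a block
    form a pi-system [Pi k], and these pi-systems are independent because
    intersecting them amounts to intersecting events over the union of the
    chosen finite index sets. *)
Section Grouping.
Variables (I K : choiceType) (g : I -> K) (F : I -> set (set T)).
Hypotheses (mF : forall i, F i `<=` measurable)
  (FI : forall i, setI_closed (F i)) (FT : forall i, F i setT)
  (indF : mutually_independent P F).

Let Pi k := [set A | exists (J : {fset I}) (E : I -> set T),
  [/\ forall i, F i (E i), forall i, i \in J -> g i = k &
      A = \bigcap_(i in [set` J]) E i]].

Let PiI k : setI_closed (Pi k).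
Proof.
move=> _ _ [J1 [E1 [FE1 g1 ->]]] [J2 [E2 [FE2 g2 ->]]].
exists (J1 `|` J2)%fset, (fun i => (if i \in J1 then E1 i else setT) `&`
  (if i \in J2 then E2 i else setT)); split.
- by move=> i; apply: FI; case: ifP.
- by move=> i /[!inE] /orP[/g1|/g2].
- apply/seteqP; split => [w [w1 w2] i /= iJ|w wJ].
    by split; case: ifPn => // ?; [exact: w1|exact: w2].
  split => i /= iJ; have := wJ i; rewrite /= inE iJ ?orbT => /(_ erefl);
  by case.
Qed.

Let indPi : mutually_independent P Pi.
Proof.
move=> D A DA.
have /choice[JE JEP] : forall k, exists JE : {fset I} * (I -> set T),
    k \in D -> [/\ forall i, F i (JE.2 i), forall i, i \in JE.1 -> g i = k &
      A k = \bigcap_(i in [set` JE.1]) JE.2 i].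
  move=> k; have [/DA[J [E H]]|kD] := boolP (k \in D); first by exists (J, E).
  by exists (fset0, fun=> setT).
pose J : {fset I} := (\bigcup_(k <- D) (JE k).1)%fset.
have JP i : reflect (g i \in D /\ i \in (JE (g i)).1) (i \in J).
  rewrite /J; apply: (iffP (bigfcupP _ _ _ _)) => [[k /andP[kD _] ik]|[gD ig]].
    by have [_ /(_ _ ik) gk _] := JEP k kD; rewrite gk.
  by exists (g i) => //; rewrite gD.
pose E i := (JE (g i)).2 i.
have JEJ k i : k \in D -> i \in (JE k).1 -> i \in J /\ g i = k.
  move=> kD ik; have [_ /(_ _ ik) gk _] := JEP k kD.
  by split=> //; apply/JP; rewrite gk.
have -> : \bigcap_(k in [set` D]) A k = \bigcap_(i in [set` J]) E i.
  apply/seteqP; split => w wA.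
    move=> i /JP[gD ig]; have [_ _ AE] := JEP _ gD.
    by have := wA _ gD; rewrite AE => /(_ i ig).
  move=> k /= kD; have [_ _ ->] := JEP _ kD => i /= ik.
  have [iJ gk] := JEJ _ _ kD ik.
  by have := wA i iJ; rewrite /E gk.
rewrite indF; last first.
  by move=> i /JP[gD ig]; have [FE _ _] := JEP _ gD; exact: FE.
transitivity (\prod_(i <- J) \prod_(k <- D | g i == k) P (E i))%E.
  apply: eq_fbigr => i /JP[gD _] _.
  rewrite (eq_bigl (pred1 (g i))); last by move=> k; rewrite /= eq_sym.
  by rewrite -big_filter filter_pred1_uniq ?fset_uniq// big_seq1.
rewrite (exchange_big_dep predT)//=; apply: eq_fbigr => k kD _.
have [FE _ ->] := JEP _ kD; rewrite indF//.
rewrite -big_filter.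
transitivity (\prod_(i <- (JE k).1) P (E i))%E.
  apply: perm_big; apply: uniq_perm; rewrite ?filter_uniq ?fset_uniq// => i.
  rewrite mem_filter; apply/andP/idP => [[/eqP <- /JP[]]//|ik].
  by have [-> ->] := JEJ _ _ kD ik; rewrite eqxx.
by apply: eq_fbigr => i ik _; rewrite /E; have [_ ->] := JEJ _ _ kD ik.
Qed.

Lemma mutually_independent_group : mutually_independent P
  (fun k => <<s \bigcup_(i in g @^-1` [set k]) F i >>).
Proof.
apply: (@mutually_independentS _ _ (fun k => <<s Pi k >>)); last first.
  apply: mutually_independent_sigma => //.
  - move=> k _ [J [E [FE _ ->]]].
    by apply: fin_bigcap_measurable => // i _; exact/mF/FE.
  - by move=> k; exists fset0, (fun=> setT); split=> //; rewrite bigcap_fset big_seq_fset0.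
move=> k; apply: sub_sigma_algebra2.
move=> A [i /= gi FA]; exists [fset i]%fset, (fun j => if j == i then A else setT).
split=> [j|j /[!inE] /eqP ->//|]; first by case: eqP => [->|].
by rewrite bigcap_fset big_seq_fset1 eqxx.
Qed.

End Grouping.

(** The converse of grouping: if the labels [l] have independent sigma-algebras
    [H] and the members of each label are independent among themselves, then the
    whole family is independent, by factoring over the labels first. *)
Lemma mutually_independent_split (I L : choiceType) (l : I -> L)
    (F : I -> set (set T)) (H : L -> set (set T)) :
  (forall a, setI_closed (H a)) -> (forall a, H a setT) ->
  (forall i, F i `<=` H (l i)) ->
  mutually_independent P H ->
  (forall a (J : {fset I}) (E : I -> set T),
    (forall i, i \in J -> l i = a /\ F i (E i)) ->
    P (\bigcap_(i in [set` J]) E i) = (\prod_(i <- J) P (E i))%E) ->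
  mutually_independent P F.
Proof.
move=> HI HT FH indH indF J E JE.
pose Ja a := [fset i in J | l i == a]%fset.
pose B a := \bigcap_(i in [set` Ja a]) E i.
have HB a : H a (B a).
  rewrite /B bigcap_fset big_seq; elim/big_ind: _ => //; first exact: HI.
  by move=> i; rewrite !inE/= => /andP[iJ /eqP <-]; exact/FH/JE.
have -> : \bigcap_(i in [set` J]) E i =
    \bigcap_(a in [set` [fset l i | i in J]%fset]) B a.
  apply/seteqP; split => w wE.
    by move=> a _ i /=; rewrite !inE/= => /andP[iJ _]; exact: wE.
  move=> i /= iJ; apply: (wE (l i)); first by apply/imfsetP; exists i.
  by rewrite /= !inE/= iJ eqxx.
rewrite indH// (partition_big_imfset _ l)/=; apply: eq_fbigr => a _ _.
rewrite /B (indF a) ?big_fset//= => i; rewrite !inE/= => /andP[iJ /eqP <-].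
by split=> //; exact: JE.
Qed.

End Independence.

(** * Comparison of laws *)

Section Laws.
Context (R : realType).

(** Boxes form a pi-system generating the sigma-algebra of tuples. The event [A]
    and the factor [c] allow the law of one family on an event to be compared
    with the law of the other, up to the probability of the event. *)
Lemma law_from_boxes d1 d2 d' (T1 : measurableType d1) (T2 : measurableType d2)
    (E : measurableType d') (P1 : probability T1 R) (P2 : probability T2 R)
    (k : nat) (X1 : 'I_k -> T1 -> E) (X2 : 'I_k -> T2 -> E)
    (A : set T1) (c : R) :
  measurable A -> 0 <= c ->
  (forall i, measurable_fun setT (X1 i)) ->
  (forall i, measurable_fun setT (X2 i)) ->
  (forall B : 'I_k -> set E, (forall i, measurable (B i)) ->
    P1 (A `&` [set w | forall i, B i (X1 i w)]) =
    (c%:E * P2 [set w | forall i, B i (X2 i w)])%E) ->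
  forall C : set (k.-tuple E), measurable C ->
    P1 (A `&` [set w | C [tuple X1 i w | i < k]]) =
    (c%:E * P2 [set w | C [tuple X2 i w | i < k]])%E.
Proof.
move=> mA c0 mX1 mX2 box C mC.
pose Y1 w := [tuple X1 i w | i < k]; pose Y2 w := [tuple X2 i w | i < k].
have mY1 : measurable_fun setT Y1.
  apply/measurable_fun_tnthP => i; rewrite (_ : _ \o _ = X1 i)//.
  by apply/funext => w /=; rewrite tnth_mktuple.
have mY2 : measurable_fun setT Y2.
  apply/measurable_fun_tnthP => i; rewrite (_ : _ \o _ = X2 i)//.
  by apply/funext => w /=; rewrite tnth_mktuple.
pose m1 : {measure set (k.-tuple E) -> \bar R} :=
  pushforward (mrestr P1 mA) Y1.
pose q : {measure set (k.-tuple E) -> \bar R} :=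
  pushforward P2 Y2.
pose m2 : {measure set (k.-tuple E) -> \bar R} := mscale (NngNum c0) (q mY2).
pose boxes := [set D : set (k.-tuple E) | exists B : 'I_k -> set E,
  (forall i, measurable (B i)) /\ D = [set x | forall i, B i (tnth x i)]].
have m1E D : m1 mY1 D = P1 (A `&` [set w | D (Y1 w)]).
  by rewrite setIC.
have m2E D : m2 D = (c%:E * P2 [set w | D (Y2 w)])%E by [].
rewrite -m1E -m2E.
apply: (@measure_unique _ _ _ boxes (fun=> setT)) => //.
- apply/seteqP; split; last first.
    apply: smallest_sub; first exact: sigma_algebra_measurable.
    move=> _ [B [mB ->]].
    rewrite (_ : [set x | _] = \bigcap_(i in [set: 'I_k]) ((@tnth _ _ ^~ i) @^-1` B i)).
      apply: fin_bigcap_measurable => // i _.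
      by rewrite -[X in measurable X]setTI; exact: measurable_tnth.
    by apply/seteqP; split=> x /= H i; [move=> _|]; exact: H.
  rewrite /measurable/= /g_sigma_preimage; apply: sub_sigma_algebra2.
  rewrite -bigcup_seq => D [i /= _ [B mB <-]].
  exists (fun j => if j == i then B else setT); split; first by move=> j; case: ifP.
  apply/seteqP; split => x /=; first by case=> _ Bx j; case: eqP => // ->.
  by move=> /(_ i); rewrite eqxx.
- move=> _ _ [B [mB ->]] [B' [mB' ->]]; exists (fun i => B i `&` B' i).
  split=> [i|]; first exact: measurableI.
  by apply/seteqP; split => x /= => [[H1 H2] i//|H]; split => i; have [] := H i.
- by move=> _; exists (fun=> setT); split=> //; apply/seteqP; split.
- by rewrite bigcup_const.
- move=> _ [B [mB ->]]; rewrite m1E m2E.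
  have -> : [set w | [set x | forall i, B i (tnth x i)] (Y1 w)] =
      [set w | forall i, B i (X1 i w)].
    by apply/seteqP; split => w /= H i; have := H i; rewrite tnth_mktuple.
  rewrite box//; congr (_ * P2 _)%E.
  by apply/seteqP; split => w /= H i; have := H i; rewrite tnth_mktuple.
- move=> _; rewrite m1E setIT.
  by rewrite (le_lt_trans (probability_le1 _ _)) ?ltry.
Qed.

Section Countable.
Context d (T : measurableType d) (C : countType) (V : T -> C).
Hypothesis mV : forall v, measurable (V @^-1` [set v]).

(* The countably many values are listed along their codes, so that the
   fibers form a sequence of sets, empty at integers which code nothing. *)
Let fiber (n : nat) : set T :=
  if pickle_inv n is Some v then V @^-1` [set v] else set0.

Let fiber_bigcup A : A = \bigcup_n (fiber n `&` A).
Proof.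
apply/seteqP; split=> [w Aw|w [n _ []//]].
by exists (choice.pickle (V w)) => //; split=> //; rewrite /fiber pickleK_inv.
Qed.

Lemma measurable_fiberwise A :
  (forall v, measurable (V @^-1` [set v] `&` A)) -> measurable A.
Proof.
move=> mA; rewrite (fiber_bigcup A); apply: bigcupT_measurable => n.
by rewrite /fiber; case: pickle_inv => [v|]; rewrite ?set0I.
Qed.

(** Used for random sums, where [V] counts the terms, and for claims selected by
    a random type. *)
Lemma measurable_fun_fiberwise d' (T' : measurableType d') (f : C -> T -> T') :
  (forall v, measurable_fun setT (f v)) ->
  measurable_fun setT (fun w => f (V w) w).
Proof.
move=> mf _ B mB; rewrite setTI; apply: measurable_fiberwise => v.
rewrite (_ : _ `&` _ = V @^-1` [set v] `&` f v @^-1` B).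
  by apply: measurableI => //; rewrite -[X in measurable X]setTI; exact: mf.
by apply/seteqP; split => w /= [<-].
Qed.

Lemma probability_fibers (P : probability T R) A : measurable A ->
  P A = (\sum_(n <oo) (if pickle_inv n is Some v
                        then P (V @^-1` [set v] `&` A) else 0))%E.
Proof.
move=> mA; rewrite {1}(fiber_bigcup A) measure_semi_bigcup//.
- apply: eq_eseriesr => n _; rewrite /fiber.
  by case: pickle_inv => [v//|]; rewrite set0I measure0.
- move=> n; apply: measurableI => //.
  by rewrite /fiber; case: pickle_inv.
- move=> m n _ _ [w [[+ _] [+ _]]]; rewrite /fiber.
  have := @pickle_invK C m; have := @pickle_invK C n.
  by case: pickle_inv => //= v; case: pickle_inv => //= u <- <- /= <- <-.
- by rewrite -fiber_bigcup.
Qed.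

End Countable.

(** Total probability over a countable variable, used to condition on the
    numbers of claims in the two descriptions of the process. *)
Lemma eq_probability_fibers d1 d2 (T1 : measurableType d1)
    (T2 : measurableType d2) (P1 : probability T1 R) (P2 : probability T2 R)
    (C : countType) (V1 : T1 -> C) (V2 : T2 -> C) (A1 : set T1) (A2 : set T2) :
  measurable A1 -> measurable A2 ->
  (forall v, measurable (V1 @^-1` [set v])) ->
  (forall v, measurable (V2 @^-1` [set v])) ->
  (forall v, P1 (V1 @^-1` [set v] `&` A1) = P2 (V2 @^-1` [set v] `&` A2)) ->
  P1 A1 = P2 A2.
Proof.
move=> mA1 mA2 mV1 mV2 H; rewrite (probability_fibers mV1)//.
rewrite (probability_fibers mV2)//; apply: eq_eseriesr => n _.
by case: pickle_inv.
Qed.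

Lemma ae_eq_probability d (T : measurableType d) (P : probability T R)
    (A B : set T) : measurable A -> measurable B ->
  {ae P, forall w, A w <-> B w} -> P A = P B.
Proof.
move=> mA mB [N [mN PN0 NP]].
rewrite -(measureU0 mA mN)// -(measureU0 mB mN)//; congr (P _).
apply/seteqP; split => w [wA|]; try by right.
  have [|nN] := pselect (N w); first by right.
  by left; apply: contrapT => nB; apply/nN/NP => /= -[/(_ wA)].
have [|nN] := pselect (N w); first by right.
by left; apply: contrapT => nB; apply/nN/NP => /= -[_ /(_ wA)].
Qed.
End Laws.

(** * Words of types and their letter counts *)

Section Combinatorics.
Context (A : finType).
Implicit Types (c : seq A) (v : {ffun A -> nat}).

Definition type_count c : {ffun A -> nat} := [ffun a => count_mem a c].

Definition total v : nat := (\sum_a v a)%N.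

Lemma total_type_count c : total (type_count c) = size c.
Proof.
rewrite /total; under eq_bigr do rewrite ffunE -sum1_count.
rewrite (exchange_big_dep predT)//= -sum1_size; apply: eq_bigr => x _.
by rewrite (eq_bigl (pred1 x)) ?big_pred1_eq// => a; rewrite /= eq_sym.
Qed.

Section Sums.
Context (R : realFieldType).
Implicit Type (F : seq A -> R).

Lemma sum_tuple0 F : \sum_(c : 0.-tuple A) F c = F [::].
Proof.
rewrite (bigD1 [tuple])//= big1 ?addr0// => c /negP[].
by apply/eqP; exact: tuple0.
Qed.

Lemma sum_tuple_cons n F :
  \sum_(c : n.+1.-tuple A) F c = \sum_x \sum_(c : n.-tuple A) F (x :: c).
Proof.
rewrite pair_big/=.
rewrite (reindex (fun xc : A * n.-tuple A => [tuple of xc.1 :: xc.2]))//=.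
exists (fun c : n.+1.-tuple A => (thead c, [tuple of behead c])).
  by move=> [x c] _; rewrite /= theadE; congr pair; apply: val_inj.
by move=> c _; rewrite -tuple_eta.
Qed.

Lemma sum_tuple_cat m n F :
  \sum_(c : (m + n).-tuple A) F c =
  \sum_(c1 : m.-tuple A) \sum_(c2 : n.-tuple A) F (c1 ++ c2).
Proof.
elim: m F => [|m IH] F.
  by rewrite (sum_tuple0 (fun c1 => \sum_(c2 : n.-tuple A) F (c1 ++ c2))).
rewrite (@sum_tuple_cons (m + n)) (@sum_tuple_cons m (fun c1 =>
  \sum_(c2 : n.-tuple A) F (c1 ++ c2))).
by apply: eq_bigr => x _; rewrite (IH (fun c => F (x :: c))).
Qed.

Variable p : A -> R.

(** The probability of the word [c] when its letters are drawn independently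
    according to [p]. *)
Definition type_weight c : R := \prod_(x <- c) p x.

(** The multinomial probability of the vector of letter counts [v]. *)
Definition multinomial v : R :=
  (total v)`!%:R * \prod_a (p a ^+ v a / (v a)`!%:R).

(** Induction on the length by splitting off the first letter [x], which lowers
    [v x] by one and contributes [v x * m!] times the common product; these
    contributions add up to [(m + 1)!] times it. *)
Lemma sum_type_weight_block n v : total v = n ->
  \sum_(c : n.-tuple A | type_count c == v) type_weight c = multinomial v.
Proof.
elim: n v => [|m IH] v tv.
  have v0 a : v a = 0%N.
    by move/eqP: tv; rewrite /total sum_nat_eq0 => /forallP/(_ a)/eqP.
  rewrite big_mkcond (sum_tuple0 (fun c => if type_count c == v then type_weight c else 0)).
  rewrite ifT; last by apply/eqP/ffunP => a; rewrite ffunE v0.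
  rewrite /multinomial tv fact0 mul1r /type_weight big_nil big1// => a _.
  by rewrite v0 expr0 fact0 divr1.
(* The counts left once a first letter x is removed. *)
pose pr x : {ffun A -> nat} := [ffun a => (v a - (a == x))%N].
rewrite big_mkcond (@sum_tuple_cons m (fun c => if type_count c == v then type_weight c else 0)).
have tpr x : (0 < v x)%N -> total (pr x) = m.
  move=> vx; apply/eqP; rewrite -eqSS -tv /total (bigD1 x)//= [in eqbRHS](bigD1 x)//=.
  rewrite ffunE eqxx -addSn subn1 prednK//; apply/eqP; congr addn.
  by apply: eq_bigr => a ax; rewrite ffunE (negbTE ax) subn0.
transitivity (\sum_x m`!%:R * (v x)%:R * \prod_a (p a ^+ v a / (v a)`!%:R)).
  apply: eq_bigr => x _.
  have [vx|vx] := posnP (v x).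
    rewrite [in RHS]vx mulr0 mul0r big1// => c _; case: eqP => // /ffunP/(_ x).
    by rewrite ffunE/= eqxx vx.
  have cE c : (type_count (x :: c) == v) = (type_count c == pr x).
    apply/eqP/eqP => /ffunP H; apply/ffunP => a; have := H a; rewrite !ffunE/=.
      by move=> <-; rewrite (eq_sym x) addKn.
    by rewrite (eq_sym x) => ->; case: eqP => [->|_]; rewrite ?add0n ?subn0// subnKC.
  under [LHS]eq_bigr do rewrite cE /type_weight big_cons.
  rewrite -big_mkcond -mulr_sumr/= (IH (pr x)) ?tpr//.
  rewrite /multinomial tpr// mulrCA -mulrA; congr (_ * _).
  rewrite (bigD1 x)//= [in RHS](bigD1 x)//= !mulrA ffunE eqxx subn1.
  congr (_ * _); last first.
    by apply: eq_bigr => a ax; rewrite ffunE (negbTE ax) subn0.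
  case: (v x) vx => // k _ /=; rewrite exprS factS natrM.
  have s0 : k.+1%:R != 0 :> R by rewrite pnatr_eq0.
  have f0 : k`!%:R != 0 :> R by rewrite pnatr_eq0 -lt0n fact_gt0.
  by field; rewrite f0 -natr1 in s0 *; apply/andP; split.
rewrite -mulr_suml -mulr_sumr -natr_sum -/(total v) tv /multinomial tv factS.
by rewrite natrM [m.+1%:R * _]mulrC.
Qed.

(** The blocks of a word are the letters of the points falling in the successive
    time intervals; disjoint blocks of an independent word are independent. *)
Lemma sum_type_weight_blocks (vs : seq {ffun A -> nat}) :
  \sum_(c : (sumn (map total vs)).-tuple A |
      map type_count (reshape (map total vs) c) == vs) type_weight c =
  \prod_(v <- vs) multinomial v.
Proof.
elim: vs => [|v vs IH] /=.
  rewrite big_nil (eq_bigl predT)//= (sum_tuple0 type_weight).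
  by rewrite /type_weight big_nil.
rewrite big_cons -IH -(sum_type_weight_block erefl) mulr_suml big_mkcond/=.
pose F c := if (type_count (take (total v) c) == v) && (map type_count
  (reshape (map total vs) (drop (total v) c)) == vs) then type_weight c else 0.
transitivity (\sum_(c : (total v + sumn (map total vs)).-tuple A) F c).
  by apply: eq_bigr => c _; rewrite /F eqseq_cons.
rewrite sum_tuple_cat [RHS]big_mkcond; apply: eq_bigr => c1 _.
rewrite /F; under [LHS]eq_bigr.
  move=> c2 _; rewrite take_size_cat ?size_tuple// drop_size_cat ?size_tuple//.
  over.
case: eqP => _ /=; last by rewrite big1.
rewrite -big_mkcond mulr_sumr; apply: eq_bigr => c2 _.
by rewrite /type_weight big_cat.
Qed.

End Sums.

(** The position in [c] of the [l]-th occurrence of the letter [a]. Beyond the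
    last occurrence it takes distinct values outside the word, so that it is
    injective in [l] without any condition ([occ_inj]). *)
Definition occ c a (l : nat) : nat :=
  nth (size c + l)%N [seq n <- iota 0 (size c) | nth a c n == a] l.

Lemma occ_inj c a : injective (occ c a).
Proof.
rewrite /occ; set s := [seq n <- _ | _] => l1 l2.
have us : uniq s by rewrite filter_uniq// iota_uniq.
have ss n : (n < size s)%N -> forall d, (nth d s n < size c)%N.
  move=> ns d; have := mem_nth d ns.
  by rewrite mem_filter mem_iota add0n => /and3P[].
have [l1s|l1s] := ltnP l1 (size s); have [l2s|l2s] := ltnP l2 (size s).
- move=> /eqP; rewrite (set_nth_default (size c + l2)%N)//.
  by rewrite nth_uniq// => /eqP.
- by rewrite [RHS]nth_default// => H; have := ss _ l1s (size c + l1)%N; rewrite H ltnNge leq_addr.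
- by rewrite [LHS]nth_default// => H; have := ss _ l2s (size c + l2)%N; rewrite -H ltnNge leq_addr.
- by rewrite !nth_default// => /addnI.
Qed.

(** Summing along a prefix of the word is summing letter by letter: the [l]-th
    term of the letter [a] is found at position [occ c a l] of the whole word,
    whatever the prefix. *)
Lemma sum_occ (V : nmodType) (x0 : A) c (F : A -> nat -> V) M : (M <= size c)%N ->
  \sum_(n < M) F (nth x0 c n) n =
  \sum_a \sum_(l < count_mem a (take M c)) F a (occ c a l).
Proof.
move=> Mc.
transitivity (\sum_(n < M) \sum_(a | nth x0 c n == a) F a n).
  apply: eq_bigr => n _; rewrite (eq_bigl (pred1 (nth x0 c n))).
    by rewrite big_pred1_eq.
  by move=> ?; rewrite /= eq_sym.
rewrite (exchange_big_dep predT)//=; apply: eq_bigr => a _.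
pose s := [seq n <- iota 0 M | nth a c n == a].
have sE : [seq n <- iota 0 (size c) | nth a c n == a] =
    s ++ [seq n <- iota M (size c - M) | nth a c n == a].
  by rewrite -filter_cat -iotaD subnKC.
have szs : size s = count_mem a (take M c).
  rewrite size_filter -(map_nth_iota0 a Mc) count_map; apply: eq_count => n.
  by [].
transitivity (\sum_(n <- s) F a n).
  rewrite big_filter -[in RHS](subn0 M) -/(index_iota 0 M) big_mkord.
  by apply: eq_bigl => n; rewrite (set_nth_default a)// (leq_trans (ltn_ord n)).
rewrite (big_nth 0%N) szs big_mkord; apply: eq_bigr => l _.
congr (F a _); rewrite /occ sE nth_cat szs ltn_ord.
by apply: set_nth_default; rewrite szs.
Qed.

Lemma count_take_flatten (vs : seq {ffun A -> nat}) c a i :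
  size c = sumn (map total vs) ->
  map type_count (reshape (map total vs) c) = vs ->
  count_mem a (take (sumn (take i (map total vs))) c) =
  (\sum_(v <- take i vs) v a)%N.
Proof.
move=> szc H.
rewrite -{1}[c](@reshapeKr _ (map total vs)) ?szc//.
set ss := reshape _ c.
have shE : shape ss = map total vs by rewrite reshapeKl// szc.
have -> : take (sumn (take i (map total vs))) (flatten ss) = flatten (take i ss).
  rewrite -[X in flatten X](cat_take_drop i) flatten_cat take_size_cat//.
  by rewrite size_flatten -shE /shape map_take.
rewrite count_flatten -[in RHS]H -map_take sumnE !big_map.
by apply: eq_bigr => s _; rewrite ffunE.
Qed.

End Combinatorics.

Arguments total {A} v.
Arguments type_count {A} c.

(** * The Poisson thinning identity *)

Section Poisson.
Context (R : realType).

(** With [0 ^+ 0 = 1] this is the point mass at 0 when [r = 0], the law of an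
    increment over an interval of length 0. The function [poisson_pmf] differs
    there: it is 1 at every [k] when [r = 0]. Such intervals come from repeated
    times. *)
Definition poisson_weight (r : R) (k : nat) : R := r ^+ k / k`!%:R * expR (- r).

Lemma poisson_weight_ge0 r k : 0 <= r -> 0 <= poisson_weight r k.
Proof. by move=> r0; rewrite mulr_ge0 ?expR_ge0// mulr_ge0// exprn_ge0. Qed.

(** In a Poisson number of points with independent types, the numbers of points
    of the various types are independent Poisson variables: the factorial of the
    total cancels, and so do the powers of the total rate. *)
Lemma poisson_weight_split (A : finType) (la : A -> R) (h : R)
    (v : {ffun A -> nat}) : \sum_a la a != 0 ->
  poisson_weight ((\sum_a la a) * h) (total v) *
    multinomial (fun a => la a / \sum_b la b) v =
  \prod_a poisson_weight (la a * h) (v a).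
Proof.
set L := \sum_a la a => L0.
rewrite /multinomial /poisson_weight.
under [RHS]eq_bigr do rewrite exprMn -mulrA.
rewrite !big_split/=.
have -> : \prod_a expR (- (la a * h)) = expR (- (L * h)).
  by rewrite -expR_sum sumrN mulr_suml.
have -> : \prod_a (la a / L) ^+ v a = \prod_a la a ^+ v a * L ^- total v.
  under eq_bigr do rewrite expr_div_n -exprVn.
  by rewrite big_split/= prodrXr exprVn.
rewrite prodrXr exprMn -/(total v).
have f0 : (total v)`!%:R != 0 :> R by rewrite pnatr_eq0 -lt0n fact_gt0.
have Lt0 : L ^+ total v != 0 by rewrite expf_neq0.
by field; apply/andP; split.
Qed.
End Poisson.

(** * Random sums and increments of Poisson processes *)

Lemma mutually_independent_fin (R : realType) (d : measure_display)
    (T : measurableType d) (P : probability T R) (I : choiceType) (J : finType)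
    (F : I -> set (set T)) (h : J -> I) (E : J -> set T) :
  mutually_independent P F -> injective h -> (forall j, F (h j) (E j)) ->
  P [set w | forall j, E j w] = (\prod_j P (E j))%E.
Proof.
move=> indF hI FE; pose D := seq_fset tt (enum J).
have inD j : j \in D by rewrite seq_fsetE mem_enum.
have := mutually_independent_inj hI indF; move=> /(_ D E (fun j _ => FE j)).
rewrite (_ : \bigcap_(i in _) _ = [set w | forall j, E j w]); last first.
  apply/seteqP; split => w /= H j; last by move=> _; exact: H.
  exact: (H j (inD j)).
move=> ->; apply: perm_big; apply: uniq_perm => [||j].
- exact: fset_uniq.
- exact: index_enum_uniq.
- by rewrite inD mem_index_enum.
Qed.

Section RandomSums.
Context (R : realType).

Lemma measurable_sum_pair d (T : measurableType d) (I : Type) (r : seq I)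
    (Q : pred I) (F : I -> T -> R * R) :
  (forall i, measurable_fun setT (F i)) ->
  measurable_fun setT (fun w => \sum_(i <- r | Q i) F i w).
Proof.
move=> mF; elim: r => [|i r IH].
  by under eq_fun do rewrite big_nil; exact: measurable_cst.
under eq_fun do rewrite big_cons.
case: (Q i) => //.
have /measurable_fun_pairP[m1 m2] := mF i.
have /measurable_fun_pairP[m3 m4] := IH.
by apply/measurable_fun_pairP; split; [exact: measurable_funD m1 m3|exact: measurable_funD m2 m4].
Qed.

Lemma measurable_tuple_event d (T : measurableType d) n (X : 'I_n -> T -> R * R)
    (B : set (n.-tuple (R * R))) :
  (forall i, measurable_fun setT (X i)) -> measurable B ->
  measurable [set w | B [tuple X i w | i < n]].
Proof.
move=> mX mB; suff mt : measurable_fun setT (fun w => [tuple X i w | i < n]).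
  by rewrite -[X in measurable X]setTI; exact: mt.
apply/measurable_fun_tnthP => i; rewrite (_ : _ \o _ = X i)//.
by apply/funext => w /=; rewrite tnth_mktuple.
Qed.

(** Finitely many claims enter the partial sums, with at most [M] of each type,
    so the sums are a measurable function of a tuple of claims and
    [law_from_boxes] applies. The hypothesis on boxes is where independence
    and the laws of the claims are used. *)
Lemma law_of_sums d1 d2 (T1 : measurableType d1) (T2 : measurableType d2)
    (P1 : probability T1 R) (P2 : probability T2 R) (A : finType)
    (W1 : A -> nat -> T1 -> R * R) (W2 : A -> nat -> T2 -> R * R)
    (E : set T1) (c : R) :
  measurable E -> 0 <= c ->
  (forall a l, measurable_fun setT (W1 a l)) ->
  (forall a l, measurable_fun setT (W2 a l)) ->
  (forall M (D : A * 'I_M -> set (R * R)), (forall x, measurable (D x)) ->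
    P1 (E `&` [set w | forall x, D x (W1 x.1 x.2 w)]) =
    (c%:E * P2 [set w | forall x, D x (W2 x.1 x.2 w)])%E) ->
  forall n (k : 'I_n -> A -> nat) (B : set (n.-tuple (R * R))), measurable B ->
    P1 (E `&` [set w | B [tuple (\sum_a \sum_(l < k i a) W1 a l w)%R | i < n]]) =
    (c%:E * P2 [set w | B [tuple (\sum_a \sum_(l < k i a) W2 a l w)%R | i < n]])%E.
Proof.
move=> mE c0 mW1 mW2 box n k B mB.
(* A crude common bound on the numbers of terms. *)
pose M := (\sum_i \sum_a k i a)%N.
have kM i a : (k i a <= M)%N.
  by rewrite /M (bigD1 i)//= (bigD1 a)//= -!addnA leq_addr.
pose K := #|{: A * 'I_M}|.
pose S (x : K.-tuple (R * R)) := [tuple \sum_a \sum_(l : 'I_M | (l < k i a)%N)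
  tnth x (enum_rank (a, l)) | i < n].
have mS : measurable_fun setT S.
  apply/measurable_fun_tnthP => i; rewrite (_ : _ \o _ = fun x => \sum_a
      \sum_(l : 'I_M | (l < k i a)%N) tnth x (enum_rank (a, l))); last first.
    by apply/funext => x /=; rewrite tnth_mktuple.
  apply: measurable_sum_pair => a; apply: measurable_sum_pair => l.
  exact: measurable_tnth.
have SE d (T : measurableType d) (W : A -> nat -> T -> R * R) w :
    S [tuple W (enum_val j).1 (enum_val j).2 w | j < K] =
    [tuple \sum_a \sum_(l < k i a) W a l w | i < n].
  apply: eq_from_tnth => i; rewrite !tnth_mktuple; apply: eq_bigr => a _.
  rewrite (big_ord_widen _ (fun l => W a l w) (kM i a)); apply: eq_bigr => l _.
  by rewrite tnth_mktuple enum_rankK.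
have mSB : measurable (S @^-1` B) by rewrite -[X in measurable X]setTI; exact: mS.
have := @law_from_boxes _ _ _ _ _ _ _ P1 P2 K
  (fun j => W1 (enum_val j).1 (enum_val j).2)
  (fun j => W2 (enum_val j).1 (enum_val j).2) E c mE c0.
move=> /(_ (fun j => mW1 _ _) (fun j => mW2 _ _)).
have step : forall D : 'I_K -> set (R * R), (forall i, measurable (D i)) ->
   P1 (E `&` [set w | forall i, D i (W1 (enum_val i).1 (enum_val i).2 w)]) =
   (c%:E * P2 [set w | forall i, D i (W2 (enum_val i).1 (enum_val i).2 w)])%E.
  move=> D mD; have := box M (fun x => D (enum_rank x)) (fun x => mD _).
  have DE d (T : measurableType d) (W : A -> nat -> T -> R * R) :
    [set w | forall x : A * 'I_M, D (enum_rank x) (W x.1 x.2 w)] =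
    [set w | forall i, D i (W (enum_val i).1 (enum_val i).2 w)].
    apply/seteqP; split => w /= H i; last by have := H (enum_rank i); rewrite enum_rankK.
    by have := H (enum_val i); rewrite enum_valK.
  by rewrite !DE.
move=> /(_ step (S @^-1` B) mSB).
by rewrite /preimage/=; under eq_set do rewrite SE; under [X in P2 X]eq_set do rewrite SE.
Qed.

End RandomSums.

Section PoissonProcess.
Context (R : realType) (d : measure_display) (T : measurableType d).
Variables (P : probability T R) (la : R) (N : R -> T -> nat).

Definition increment (tau : nat -> R) (j : nat) (w : T) : nat :=
  (N (tau j.+1) w - N (tau j) w)%N.

Variables (tau : nat -> R).
Hypotheses (la_gt0 : 0 < la) (poissonN : poisson_process P la N).
Hypotheses (tau0 : tau 0%N = 0)
  (tau_homo : {homo tau : i j / (i <= j)%N >-> i <= j}).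

Let tau_ge0 j : 0 <= tau j.
Proof. by rewrite -tau0; exact: tau_homo. Qed.

Lemma sigma_rv_increment j :
  sigma_rv (increment tau j) `<=` sigma_family times N.
Proof.
pose G := \bigcup_(t in times) sigma_rv (N t).
pose TG : measurableType _ := g_sigma_algebraType G.
have mN i : measurable_fun (setT : set TG) (N (tau i) : TG -> nat).
  move=> _ B _; rewrite setTI; apply: sub_sigma_algebra; exists (tau i) => //=.
  by exists B; rewrite ?setTI.
have mI : measurable_fun (setT : set TG) (increment tau j : TG -> nat).
  apply: (@measurable_fun_fiberwise _ TG nat (N (tau j.+1)) _ _ _
    (fun m w => (m - N (tau j) w)%N)).
    move=> i; rewrite -[X in measurable X]setTI; exact: mN.
  by move=> i; apply: (measurableT_comp (f := fun l => (i - l)%N)).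
by move=> _ [B mB <-]; exact: mI.
Qed.

Lemma sigma_family_increment j m :
  sigma_family times N [set w | increment tau j w = m].
Proof. by apply: sigma_rv_increment; exists [set m] => //; rewrite setTI. Qed.

Lemma sigma_family_increments n (k : 'I_n -> nat) :
  sigma_family times N [set w | forall j : 'I_n, increment tau j w = k j].
Proof.
rewrite (_ : [set w | _] = \bigcap_(j in [set: 'I_n])
    [set w | increment tau j w = k j]); last first.
  by apply/seteqP; split => w /= H j; [move=> _; exact: H|exact: H].
apply: (@fin_bigcap_measurable _ (g_sigma_algebraType _)) => // j _.
exact: sigma_family_increment.
Qed.

Lemma sigma_family_times_measurable : sigma_family times N `<=` measurable.
Proof.
apply: smallest_sub; first exact: sigma_algebra_measurable.
move=> _ [t /= t0 [B mB <-]]; exact: (poisson_process_measurable poissonN).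
Qed.

(** The assumed law of the increments concerns intervals of positive length; on
    an interval of length 0 the increment vanishes. *)
Lemma poisson_increment j k : P [set w | increment tau j w = k] =
  (poisson_weight (la * (tau j.+1 - tau j)) k)%:E.
Proof.
have := tau_homo (leqnSn j); rewrite le_eqVlt => /predU1P[tE|tlt].
  rewrite -tE subrr mulr0 /poisson_weight oppr0 expR0 mulr1.
  rewrite (_ : [set w | _] = if k == 0%N then setT else set0); last first.
    rewrite /increment -tE; apply/seteqP; split => w /=; rewrite subnn.
      by move=> <-.
    by case: eqP.
  case: eqP => [->|/eqP k0]; first by rewrite expr0 fact0 divr1 probability_setT.
  by rewrite expr0n (negbTE k0) mul0r measure0.
rewrite (poisson_process_increment_law poissonN)//.
by rewrite /poisson_pmf mulr_gt0 ?subr_gt0.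
Qed.

Lemma poisson_increments n (k : 'I_n -> nat) :
  P [set w | forall j : 'I_n, increment tau j w = k j] =
  (\prod_(j < n) poisson_weight (la * (tau j.+1 - tau j)) (k j))%:E.
Proof.
have ind := poisson_process_independent_increments poissonN (tau_ge0 0) tau_homo.
rewrite (@mutually_independent_fin _ _ _ _ _ _ _ (fun j : 'I_n => val j)
  (fun j => [set w | increment tau j w = k j]) ind val_inj).
  by rewrite -prodEFin; apply: eq_bigr => j _; rewrite poisson_increment.
by move=> j; exists [set k j] => //; rewrite setTI.
Qed.

(** Increments are truncated differences, so they telescope only along the
    nondecreasing paths. *)
Lemma ae_sum_increments :
  {ae P, forall w j, N (tau j) w = (\sum_(i < j) increment tau i w)%N}.
Proof.
apply: filterS (poisson_process_path poissonN) => w [N0 Nhomo _].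
elim=> [|j IH]; first by rewrite big_ord0 tau0.
by rewrite big_ord_recr/= -IH subnKC// Nhomo// tau_homo.
Qed.

End PoissonProcess.

(** Finite dimensional distributions are taken at times in arbitrary order and
    with repetitions, whereas independence is about increments over consecutive
    intervals. Sorting the times and putting 0 in front passes from one to the
    other; the sequence is made constant after the last time, so repeated times
    and the tail give increments over intervals of length 0. *)
Lemma ordered_times (R : realType) n (t : n.-tuple R) :
  (forall i, 0 <= tnth t i) ->
  exists (tau : nat -> R) (k : 'I_n -> nat),
    [/\ tau 0%N = 0, {homo tau : i j / (i <= j)%N >-> i <= j},
        forall i, tau (k i) = tnth t i & forall i, (k i <= n)%N].
Proof.
move=> t0; pose s := 0 :: sort <=%R t.
have szs : size s = n.+1 by rewrite /= size_sort size_tuple.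
have sorted_s : sorted <=%R s.
  rewrite /= path_min_sorted; first by apply: sort_sorted; exact: le_total.
  by apply/allP => x; rewrite mem_sort => /tnthP[i ->].
exists (fun j => nth 0 s (minn j n)), (fun i => (index (tnth t i) (sort <=%R t)).+1).
have ik i : (index (tnth t i) (sort <=%R t) < n)%N.
  by rewrite -[X in (_ < X)%N](size_tuple t) -(size_sort <=%R) index_mem mem_sort mem_tnth.
split => //.
- by rewrite min0n.
- move=> i j ij; apply: le_sorted_leq_nth => //.
  + by rewrite inE szs ltnS geq_minr.
  + by rewrite inE szs ltnS geq_minr.
  + by rewrite leq_min geq_minr (leq_trans (geq_minl _ _)).
- move=> i; rewrite (minn_idPl _)//= nth_index// mem_sort; exact: mem_tnth.
Qed.

(** * Superposition and thinning at fixed times *)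

Lemma mkseq_eqP (T : Type) (x0 : T) (f : nat -> T) n s : size s = n ->
  mkseq f n = s <-> forall j : 'I_n, f j = nth x0 s j.
Proof.
move=> sn; split => [<- j|H]; first by rewrite nth_mkseq.
apply: (@eq_from_nth _ x0); rewrite size_mkseq// => j jn.
by rewrite nth_mkseq// (H (Ordinal jn)).
Qed.

Section CountableValued.
Context d (T : measurableType d).

Lemma measurable_countable_preimage (C : countType) (V : T -> C) (S : set C) :
  (forall v, measurable (V @^-1` [set v])) -> measurable (V @^-1` S).
Proof.
move=> mV; apply: (@measurable_fiberwise _ _ _ V) => v.
have [Sv|Sv] := pselect (S v).
  by rewrite setIidl//= => w /= ->.
by rewrite (_ : _ `&` _ = set0)// -subset0 => w [/= ->].
Qed.

Lemma measurable_mkseq (C : countType) (V : nat -> T -> C) n (S : set (seq C)) :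
  (forall j v, measurable (V j @^-1` [set v])) ->
  measurable [set w | S (mkseq (V^~ w) n)].
Proof.
move=> mV; apply: (@measurable_countable_preimage _ (fun w => mkseq (V^~ w) n)) => s.
have [sn|sn] := eqVneq (size s) n; last first.
  rewrite (_ : _ @^-1` _ = set0)// -subset0 => w /= ws.
  by move: sn; rewrite -ws size_mkseq eqxx.
case: s => [|x0 s] in sn *.
  rewrite -sn (_ : _ @^-1` _ = setT)//; exact/seteqP.
rewrite (_ : _ @^-1` _ = \bigcap_(j in [set: 'I_n]) V j @^-1` [set nth x0 (x0 :: s) j]).
  by apply: fin_bigcap_measurable.
by apply/seteqP; split => w /=; rewrite (mkseq_eqP x0)// => H j; [move=> _|]; exact: H.
Qed.

End CountableValued.

(** The number of claims of type [a] up to time [tau k], when [vs] lists the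
    counts of the successive intervals. *)
Definition prefix_count (A : finType) (vs : seq {ffun A -> nat}) k a : nat :=
  (\sum_(v <- take k vs) v a)%N.

Section Superposition.
Context (R : realType) (A : finType) (d : measure_display)
  (T : measurableType d) (P : probability T R).
Variables (la : A -> R) (N : A -> R -> T -> nat) (W : A -> nat -> T -> R * R).
Hypotheses (la_gt0 : forall a, 0 < la a)
  (poissonN : forall a, poisson_process P (la a) (N a))
  (mW : forall a l, measurable_fun setT (W a l))
  (indep : mutually_independent P (fun x : A + A * nat =>
     match x with
     | inl a => sigma_family times (N a)
     | inr y => sigma_rv (W y.1 y.2)
     end)).
Variables (tau : nat -> R) (n : nat).
Hypotheses (tau0 : tau 0%N = 0)
  (tau_homo : {homo tau : i j / (i <= j)%N >-> i <= j}).

Definition count_blocks (w : T) : seq {ffun A -> nat} :=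
  mkseq (fun j => [ffun a => increment (N a) tau j w]) n.

(** The probability of the counts [vs] under independent Poisson processes. *)
Definition block_weight (vs : seq {ffun A -> nat}) : R :=
  \prod_(j < n) \prod_a
    poisson_weight (la a * (tau j.+1 - tau j)) (nth [ffun=> 0%N] vs j a).

Lemma block_weight_ge0 vs : 0 <= block_weight vs.
Proof.
apply: prodr_ge0 => j _; apply: prodr_ge0 => a _; apply: poisson_weight_ge0.
by rewrite mulr_ge0 ?subr_ge0 ?(ltW (la_gt0 _)) ?tau_homo.
Qed.

Let block_event (vs : seq {ffun A -> nat}) a := [set w | forall j : 'I_n,
   increment (N a) tau j w = nth [ffun=> 0%N] vs j a].

Let block_eventE vs : size vs = n ->
  [set w | count_blocks w = vs] = [set w | forall a, block_event vs a w].
Proof.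
move=> sn; apply/seteqP; split => w /=; rewrite /count_blocks (mkseq_eqP [ffun=> 0%N])//.
  by move=> H a j; rewrite -H ffunE.
by move=> H j; apply/ffunP => a; rewrite ffunE H.
Qed.

Lemma measurable_count_blocks vs : measurable [set w | count_blocks w = vs].
Proof.
have [sn|sn] := eqVneq (size vs) n; last first.
  rewrite (_ : [set w | _] = set0)// -subset0 => w /= ws.
  by move: sn; rewrite -ws size_mkseq eqxx.
rewrite block_eventE// (_ : [set w | _] = \bigcap_(a in [set: A]) block_event vs a).
  apply: fin_bigcap_measurable => // a _.
  apply: (sigma_family_times_measurable (poissonN a)).
  exact: (sigma_family_increments tau0 tau_homo).
by apply/seteqP; split => w /= H a; [move=> _; exact: H|exact: H].
Qed.

(** On the event that the counts are [vs], the values of the process are sums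
    with a fixed number of terms, which are independent of this event. *)
Lemma superposition_law (k : 'I_n -> nat) (B : set (n.-tuple (R * R)))
    (vs : seq {ffun A -> nat}) : measurable B -> size vs = n ->
  let S := [set w | B [tuple (\sum_a \sum_(l < prefix_count vs (k i) a)
                                W a l w)%R | i < n]] in
  P ([set w | count_blocks w = vs] `&` S) = ((block_weight vs)%:E * P S)%E.
Proof.
move=> mB sn S; rewrite {}/S.
apply: (@law_of_sums _ _ _ _ _ P P A W W) => //.
- exact: measurable_count_blocks.
- exact: block_weight_ge0.
move=> M D mD; rewrite block_eventE//.
(* Counts and claims as one finite family of independent events. *)
pose E (x : A + A * 'I_M) : set T := match x with
  | inl a => block_event vs a
  | inr y => [set w | D y (W y.1 y.2 w)] end.
pose h (x : A + A * 'I_M) : A + A * nat := match x with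
  | inl a => inl a
  | inr y => inr (y.1, val y.2) end.
have hI : injective h.
  by move=> [a|[a l]] [b|[b m]]//= [->]// /val_inj ->.
have -> : [set w | forall a, block_event vs a w] `&`
    [set w | forall x, D x (W x.1 x.2 w)] = [set w | forall x, E x w].
  apply/seteqP; split => w /=; first by case=> H1 H2 [a|y]; [exact: H1|exact: H2].
  move=> H; split => [a|y]; first by have := H (inl a).
  by have := H (inr y).
have sD (y : A * 'I_M) : sigma_rv (W y.1 y.2) [set w | D y (W y.1 y.2 w)].
  by exists (D y) => //; rewrite setTI.
rewrite (mutually_independent_fin indep hI); last first.
  by case=> [a|y]; [exact: sigma_family_increments|exact: sD].
have hI2 : injective (h \o inr) by move=> x y /hI[].
rewrite (mutually_independent_fin indep hI2 (E := fun y => [set w | D y (W y.1 y.2 w)]))//.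
rewrite big_sumType/= /block_weight exchange_big/= -prodEFin; congr (_ * _)%E.
by apply: eq_bigr => a _; exact: poisson_increments.
Qed.

End Superposition.

Section Thinning.
Context (R : realType) (A : finType) (d : measure_display)
  (T : measurableType d) (P : probability T R).
Variables (la : A -> R) (N : R -> T -> nat) (C : nat -> T -> A)
  (W : A -> nat -> T -> R * R).
Hypotheses (la_gt0 : forall a, 0 < la a)
  (poissonN : poisson_process P (\sum_a la a) N)
  (mC : forall m a, measurable (C m @^-1` [set a]))
  (lawC : forall m a, P (C m @^-1` [set a]) = (la a / \sum_b la b)%:E)
  (mW : forall a l, measurable_fun setT (W a l))
  (indep : mutually_independent P (fun x : unit + (nat + A * nat) =>
     match x with
     | inl _ => sigma_family times N
     | inr (inl m) => preimage_set_system setT (C m) setT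
     | inr (inr y) => sigma_rv (W y.1 y.2)
     end)).
Variables (tau : nat -> R) (n : nat).
Hypotheses (tau0 : tau 0%N = 0)
  (tau_homo : {homo tau : i j / (i <= j)%N >-> i <= j}).
Context d' (T' : measurableType d') (P' : probability T' R)
  (W' : A -> nat -> T' -> R * R).
Hypotheses (mW' : forall a l, measurable_fun setT (W' a l))
  (indW' : mutually_independent P' (fun y : A * nat => sigma_rv (W' y.1 y.2)))
  (lawW : forall a l l', same_law P' (W' a l) P (W a l')).

Definition block_sizes (w : T) : seq nat := mkseq (fun j => increment N tau j w) n.

(** The types of the points are cut into blocks according to the intervals in
    which the points fall; the counts of the blocks correspond to [count_blocks]
    for the superposition. *)
Definition type_blocks (w : T) : seq {ffun A -> nat} :=
  map (@type_count A) (reshape (block_sizes w) (mkseq (C^~ w) (sumn (block_sizes w)))).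

Let sum_la_gt0 : 0 < \sum_a la a.
Proof.
have [w _] : (setT : set T) !=set0.
  apply/set0P/eqP => T0; have := @probability_setT _ _ _ P.
  by rewrite T0 measure0 => /esym/eqP; rewrite onee_eq0.
by rewrite (bigD1 (C 0%N w))//= ltr_wpDr// sumr_ge0// => a _; exact: ltW.
Qed.

Lemma total_type_blocks w : map total (type_blocks w) = block_sizes w.
Proof.
rewrite -map_comp (eq_map (@total_type_count A)).
by rewrite -[RHS](@reshapeKl _ _ (mkseq (C^~ w) (sumn (block_sizes w)))) ?size_mkseq.
Qed.

Let increment_measurable j v : measurable ((increment N tau j) @^-1` [set v]).
Proof.
apply: (sigma_family_times_measurable poissonN).
exact: (sigma_family_increment tau0 tau_homo).
Qed.

Lemma measurable_type_blocks vs : measurable [set w | type_blocks w = vs].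
Proof.
have mds : forall s, measurable (block_sizes @^-1` [set s]).
  by move=> s; exact: measurable_mkseq.
apply: (@measurable_fiberwise _ _ _ block_sizes) => s.
rewrite (_ : _ `&` _ = block_sizes @^-1` [set s] `&` [set w |
  [set c | map (@type_count A) (reshape s c) = vs] (mkseq (C^~ w) (sumn s))]).
  by apply: measurableI => //; exact: measurable_mkseq.
by apply/seteqP; split => w /= [<-].
Qed.

(** The event that the counts are [vs] is split over the words [c] of types that
    give these counts. Once [c] is fixed, the claim of the [l]-th point of type
    [a] is [W a (occ c a l)]. Since [occ c a] is injective and [c] is
    independent of the claims, the sums have on this event the law of the sums
    of independent claims [W'], times the probability of the event. It remains
    to sum over [c] the probabilities, which is the multinomial theorem, and to
    recognize the Poisson weights of the types. *)
Lemma thinning_law (k : 'I_n -> nat) (B : set (n.-tuple (R * R)))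
    (vs : seq {ffun A -> nat}) : measurable B -> size vs = n ->
  P ([set w | type_blocks w = vs] `&`
     [set w | B [tuple (\sum_(m < sumn (take (k i) (block_sizes w)))
                          W (C m w) m w)%R | i < n]]) =
  ((block_weight la tau n vs)%:E *
   P' [set w | B [tuple (\sum_a \sum_(l < prefix_count vs (k i) a)
                           W' a l w)%R | i < n]])%E.
Proof.
move=> mB sn; set g := P' _.
pose D := map total vs; pose M := sumn D.
pose E (c : M.-tuple A) := [set w | block_sizes w = D /\ mkseq (C^~ w) M = c].
pose S (c : M.-tuple A) := [set w | B [tuple (\sum_a
  \sum_(l < prefix_count vs (k i) a) W a (occ c a l) w)%R | i < n]].
pose Q (c : M.-tuple A) := map (@type_count A) (reshape D c) == vs.
(* Splitting over the words with the given counts. *)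
have -> : [set w | type_blocks w = vs] `&`
     [set w | B [tuple (\sum_(m < sumn (take (k i) (block_sizes w)))
                          W (C m w) m w)%R | i < n]] =
    \bigcup_(c in [set c | Q c]) (E c `&` S c).
  have key (c : M.-tuple A) w : E c w -> Q c ->
      [tuple (\sum_(m < sumn (take (k i) (block_sizes w))) W (C m w) m w)%R | i < n] =
      [tuple (\sum_a \sum_(l < prefix_count vs (k i) a) W a (occ c a l) w)%R | i < n].
    move=> [dsE cE] /eqP Qc; apply: eq_from_tnth => i; rewrite !tnth_mktuple dsE.
    have MM : (sumn (take (k i) D) <= size c)%N.
      by rewrite size_tuple -[X in (_ <= sumn X)%N](cat_take_drop (k i)) sumn_cat leq_addr.
    under eq_bigr => m _.
      have mM : (m < M)%N by rewrite (leq_trans (ltn_ord m))// -(size_tuple c).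
      rewrite (_ : C m w = nth (C 0%N w) c m); last by rewrite -cE nth_mkseq.
      over.
    rewrite /= (sum_occ (C 0%N w) (fun a m => W a m w) MM); apply: eq_bigr => a _.
    by rewrite (count_take_flatten _ _ _ Qc) ?size_tuple.
  apply/seteqP; split => w /=.
    move=> [tE Bw].
    have dsE : block_sizes w = D by rewrite -total_type_blocks tE.
    have szM : size (mkseq (C^~ w) M) == M by rewrite size_mkseq.
    have Ew : E (Tuple szM) w by [].
    have Qc : Q (Tuple szM) by rewrite /Q/= -tE /type_blocks dsE.
    by exists (Tuple szM) => //; split => //; rewrite /S/= -key.
  move=> [c Qc [Ew Sw]]; have [dsE cE] := Ew; split.
    by rewrite /type_blocks dsE -/M cE; exact/eqP.
  by rewrite (key c).
pose p a := la a / \sum_b la b.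
pose K := \prod_(j < n) poisson_weight ((\sum_a la a) * (tau j.+1 - tau j)) (nth 0%N D j).
have K0 : 0 <= K.
  apply: prodr_ge0 => j _; apply: poisson_weight_ge0.
  by rewrite mulr_ge0 ?subr_ge0 ?tau_homo// sumr_ge0// => a _; exact: ltW.
have p0 a : 0 <= p a by rewrite divr_ge0 ?sumr_ge0 ?ltW// => b _; exact: ltW.
have szD : size D = n by rewrite size_map.
pose F (c : M.-tuple A) (x : unit + 'I_M) : set T := match x with
  | inl _ => [set w | forall j : 'I_n, increment N tau j w = nth 0%N D j]
  | inr m => C m @^-1` [set tnth c m] end.
have EF c : E c = [set w | forall x, F c x w].
  apply/seteqP; split => w /=.
    move=> [/(mkseq_eqP 0%N) dsE]; rewrite (mkseq_eqP (C 0%N w)) ?size_tuple// => cE.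
    case=> [_|m] /=; first exact/dsE.
    by rewrite cE (tnth_nth (C 0%N w)).
  move=> H; split; first by apply/(mkseq_eqP 0%N) => //; exact: (H (inl tt)).
  apply/(mkseq_eqP (C 0%N w)); rewrite ?size_tuple// => m.
  by have := H (inr m); rewrite /= (tnth_nth (C 0%N w)).
have mF c x : measurable (F c x).
  case: x => [_|m] /=; last exact: mC.
  apply: (sigma_family_times_measurable poissonN).
  exact: (sigma_family_increments tau0 tau_homo).
have mE c : measurable (E c).
  rewrite EF (_ : [set w | _] = \bigcap_(x in setT) F c x).
    exact: fin_bigcap_measurable.
  by apply/seteqP; split => w /= H x; [move=> _|]; exact: H.
have msums d0 (T0 : measurableType d0) (X : A -> nat -> T0 -> R * R) :
    (forall a l, measurable_fun setT (X a l)) -> measurable [set w | B [tuple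
      (\sum_a \sum_(l < prefix_count vs (k i) a) X a l w)%R | i < n]].
  move=> mX; apply: measurable_tuple_event => // i.
  by apply: measurable_sum_pair => a; exact: measurable_sum_pair.
(* On the event E c the claims are renumbered by occ, and g is the probability
   of the corresponding event for the claims W'. *)
have PES c : P (E c `&` S c) = ((K * type_weight p c)%:E * g)%E.
  apply: (@law_of_sums _ _ _ _ _ P P' A (fun a l => W a (occ c a l)) W') => //.
    by rewrite mulr_ge0// prodr_ge0.
  move=> M' D' mD'.
  pose G (x : (unit + 'I_M) + A * 'I_M') : set T := match x with
    | inl y => F c y
    | inr z => [set w | D' z (W z.1 (occ c z.1 z.2) w)] end.
  pose h (x : (unit + 'I_M) + A * 'I_M') : unit + (nat + A * nat) :=
    match x with
    | inl (inl y) => inl y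
    | inl (inr m) => inr (inl (val m))
    | inr z => inr (inr (z.1, occ c z.1 z.2)) end.
  have hI : injective h.
    move=> [[[]|m]|[a l]] [[[]|m']|[a' l']] //=.
      by case=> /val_inj ->.
    by case=> -> /occ_inj /val_inj ->.
  pose h' (z : A * 'I_M') : A * nat := (z.1, val z.2).
  have hI' : injective h' by move=> [a l] [a' l'] [-> /val_inj ->].
  have -> : E c `&` [set w | forall x, D' x (W x.1 (occ c x.1 x.2) w)] =
      [set w | forall x, G x w].
    rewrite EF; apply/seteqP; split => w /=.
      by case=> H1 H2 [x|z]; [exact: H1|exact: H2].
    move=> H; split=> [x|z]; first by have := H (inl x).
    by have := H (inr z).
  rewrite (mutually_independent_fin indep hI); last first.
    case=> [[[]|m]|z] /=.
    - exact: (sigma_family_increments tau0 tau_homo).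
    - by exists [set tnth c m] => //; rewrite setTI.
    - by exists (D' z) => //; rewrite setTI.
  rewrite (mutually_independent_fin indW' hI'
    (E := fun z => [set w | D' z (W' z.1 z.2 w)])); last first.
    by move=> z; exists (D' z) => //; rewrite setTI.
  rewrite !big_sumType/=; congr (_ * _)%E; last first.
    by apply: eq_bigr => z _; exact/esym/(@lawW _ _ _ _ (mD' z)).
  rewrite (big_pred1 tt); last by case.
  rewrite EFinM; congr (_ * _)%E.
    by rewrite (poisson_increments _ poissonN tau0 tau_homo).
  rewrite /type_weight big_tuple -prodEFin; apply: eq_bigr => m _.
  exact: lawC.
rewrite measure_fin_bigcup//; last 3 first.
- exact: finite_finset.
- move=> c c' _ _ [w [[[_ cE] _] [[_ c'E] _]]].
  by apply: val_inj; rewrite /= -cE -c'E.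
- by move=> c _; apply: measurableI => //; exact: (msums _ _ (fun a l => W a (occ c a l))).
rewrite (fsbigE [seq c <- index_enum _ | Q c]); last 3 first.
- by rewrite filter_uniq// index_enum_uniq.
- by move=> c /=; rewrite mem_filter => /andP[].
- by move=> c /= Qc; rewrite mem_filter Qc mem_index_enum.
(* The sum over the words is finite and takes place in R. *)
have gE : g = (fine g)%:E by rewrite fineK// fin_num_measure//; exact: msums.
transitivity (\sum_(c : M.-tuple A | Q c) (K * type_weight p c * fine g)%:E)%E.
  rewrite [LHS]big_filter_cond; apply: eq_big => [c|c _]; last by rewrite EFinM -gE; exact: PES.
  by rewrite mem_setE/= andbb.
rewrite sumEFin -mulr_suml -mulr_sumr sum_type_weight_blocks.
rewrite [in RHS]gE -EFinM; congr ((_ * _)%:E).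
rewrite /K (big_nth [ffun=> 0%N]) sn big_mkord -big_split/=; apply: eq_bigr => j _.
rewrite (nth_map [ffun=> 0%N]) ?sn// poisson_weight_split//.
by rewrite gt_eqF.
Qed.

End Thinning.

(** * Equality of the finite dimensional distributions *)

(** Both sides are conditioned on the counts of the claims of each type in each
    interval. By [superposition_law] and [thinning_law], the joint probability
    with each value of the counts is the same product. The claims in the
    marked process are indexed by type and rank of the point, so that the point
    of rank [m] picks [W2 (C m) m] among the claims of that rank. *)
Theorem superposition_fdd_thinning (R : realType) (A : finType)
    (d1 : measure_display) (T1 : measurableType d1) (P1 : probability T1 R)
    (d2 : measure_display) (T2 : measurableType d2) (P2 : probability T2 R)
    (la : A -> R) (N1 : A -> R -> T1 -> nat) (W1 : A -> nat -> T1 -> R * R)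
    (N2 : R -> T2 -> nat) (C : nat -> T2 -> A) (W2 : A -> nat -> T2 -> R * R) :
  (forall a, 0 < la a) ->
  (forall a, poisson_process P1 (la a) (N1 a)) ->
  (forall a l, measurable_fun setT (W1 a l)) ->
  mutually_independent P1 (fun x : A + A * nat =>
    match x with
    | inl a => sigma_family times (N1 a)
    | inr y => sigma_rv (W1 y.1 y.2)
    end) ->
  poisson_process P2 (\sum_a la a) N2 ->
  (forall m a, measurable (C m @^-1` [set a])) ->
  (forall m a, P2 (C m @^-1` [set a]) = (la a / \sum_b la b)%:E) ->
  (forall a l, measurable_fun setT (W2 a l)) ->
  mutually_independent P2 (fun x : unit + (nat + A * nat) =>
    match x with
    | inl _ => sigma_family times N2
    | inr (inl m) => preimage_set_system setT (C m) setT
    | inr (inr y) => sigma_rv (W2 y.1 y.2)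
    end) ->
  (forall a l l', same_law P1 (W1 a l) P2 (W2 a l')) ->
  fdd_equal P1 (fun t w => \sum_a \sum_(l < N1 a t w) W1 a l w)
            P2 (fun t w => \sum_(m < N2 t w) W2 (C m w) m w).
Proof.
move=> la0 pN1 mW1 ind1 pN2 mC lawC mW2 ind2 lawW n t t0 B mB.
have [tau [k [tau0 tau_homo tauk kn]]] := ordered_times t0.
have ind1W : mutually_independent P1 (fun y : A * nat => sigma_rv (W1 y.1 y.2)).
  by have := mutually_independent_inj (h := @inr A (A * nat)) (@inr_inj _ _) ind1.
have mW2C m : measurable_fun setT (fun w => W2 (C m w) m w).
  exact: (measurable_fun_fiberwise (mC m) (f := fun a w => W2 a m w)).
have mfib d (T : measurableType d) (K : T -> nat) :
    measurable_fun setT K -> forall v, measurable (K @^-1` [set v]).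
  by move=> mK v; rewrite -[X in measurable X]setTI; exact: mK.
(* X1 and X2 are the processes at the given times. Y1 and Y2 express them by
   increments; they agree with X1 and X2 on nondecreasing paths only. *)
pose V1 := count_blocks N1 tau n.
pose V2 := type_blocks N2 C tau n.
pose ds := block_sizes N2 tau n.
pose X1 w := [tuple \sum_a \sum_(l < N1 a (tnth t i) w) W1 a l w | i < n].
pose X2 w := [tuple \sum_(m < N2 (tnth t i) w) W2 (C m w) m w | i < n].
pose Y1 w := [tuple \sum_a \sum_(l < prefix_count (V1 w) (k i) a) W1 a l w | i < n].
pose Y2 w := [tuple \sum_(m < sumn (take (k i) (ds w))) W2 (C m w) m w | i < n].
have mV1 v : measurable (V1 @^-1` [set v]).
  exact: (measurable_count_blocks pN1 n tau0 tau_homo).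
have mds v : measurable (ds @^-1` [set v]).
  apply: measurable_mkseq => j u.
  apply: (sigma_family_times_measurable pN2).
  exact: (sigma_family_increment tau0 tau_homo).
have mV2 v : measurable (V2 @^-1` [set v]).
  exact: (measurable_type_blocks pN2 mC n tau0 tau_homo).
have mX1 : measurable (X1 @^-1` B).
  apply: measurable_tuple_event => // i; apply: measurable_sum_pair => a.
  apply: (measurable_fun_fiberwise (V := N1 a (tnth t i)) _
    (f := fun v w => \sum_(l < v) W1 a l w)) => v.
    exact/mfib/(poisson_process_measurable (pN1 a)).
  exact: measurable_sum_pair.
have mX2 : measurable (X2 @^-1` B).
  apply: measurable_tuple_event => // i.
  apply: (measurable_fun_fiberwise (V := N2 (tnth t i)) _
    (f := fun v w => \sum_(m < v) W2 (C m w) m w)) => v.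
    exact/mfib/(poisson_process_measurable pN2).
  exact: measurable_sum_pair.
have mY1 : measurable (Y1 @^-1` B).
  apply: measurable_tuple_event => // i.
  apply: (measurable_fun_fiberwise mV1
    (f := fun v w => \sum_a \sum_(l < prefix_count v (k i) a) W1 a l w)) => v.
  by apply: measurable_sum_pair => a; exact: measurable_sum_pair.
have mY2 : measurable (Y2 @^-1` B).
  apply: measurable_tuple_event => // i.
  apply: (measurable_fun_fiberwise mds
    (f := fun v w => \sum_(m < sumn (take (k i) v)) W2 (C m w) m w)) => v.
  exact: measurable_sum_pair.
change (P1 (X1 @^-1` B) = P2 (X2 @^-1` B)).
transitivity (P1 (Y1 @^-1` B)).
  apply: ae_eq_probability => //.
  have := filter_forall (ae_filter_ringOfSetsType P1)
    (fun a => ae_sum_increments (pN1 a) tau0 tau_homo).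
  apply: filterS => w Nw; rewrite /preimage/=; suff -> : X1 w = Y1 w by [].
  apply: eq_from_tnth => i; rewrite !tnth_mktuple -tauk; apply: eq_bigr => a _.
  rewrite Nw (_ : prefix_count _ _ _ = \sum_(j < k i) increment (N1 a) tau j w)%N//.
  rewrite /prefix_count /V1 /count_blocks /mkseq -map_take take_iota (minn_idPl (kn i)).
  rewrite big_map -{1}[k i]subn0 -/(index_iota 0 (k i)) big_mkord.
  by apply: eq_bigr => j _; rewrite ffunE.
transitivity (P2 (Y2 @^-1` B)); last first.
  apply: ae_eq_probability => //.
  apply: filterS (ae_sum_increments pN2 tau0 tau_homo) => w Nw.
  rewrite /preimage/=; suff -> : X2 w = Y2 w by [].
  apply: eq_from_tnth => i; rewrite !tnth_mktuple -tauk Nw.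
  rewrite /ds /block_sizes /mkseq -map_take take_iota (minn_idPl (kn i)).
  rewrite -(big_mkord xpredT (fun j => increment N2 tau j w)) /index_iota subn0.
  by rewrite sumnE big_map.
apply: (eq_probability_fibers mY1 mY2 mV1 mV2) => v.
have [sv|sv] := eqVneq (size v) n; last first.
  rewrite (_ : _ `&` _ = set0).
    rewrite (_ : _ `&` _ = set0) ?measure0//.
    rewrite -subset0 => w [/= wv _].
    by move: sv; rewrite -wv /V2/= size_map size_reshape size_mkseq eqxx.
  rewrite -subset0 => w [/= wv _].
  by move: sv; rewrite -wv size_mkseq eqxx.
apply: (etrans _ (esym (thinning_law la0 pN2 mC lawC mW2 ind2 tau0 tau_homo
  mW1 ind1W lawW k mB sv))).
apply: (etrans _ (superposition_law la0 pN1 mW1 ind1 tau0 tau_homo k mB sv)).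
by congr (P1 _); apply/seteqP; split => w /= [<-].
Qed.

(** * Independence of sequences of variables *)

Section MoreIndependence.
Context (R : realType) (d : measure_display) (T : measurableType d)
  (P : probability T R).

Lemma sub_sigma_rv_measurable d' (T' : measurableType d') (X : T -> T') :
  measurable_fun setT X -> sigma_rv X `<=` measurable.
Proof. by move=> mX _ [B mB <-]; exact: mX. Qed.

Lemma sigma_rv_setI d' (T' : measurableType d') (X : T -> T') :
  setI_closed (sigma_rv X).
Proof.
move=> _ _ [B mB <-] [C mC <-]; exists (B `&` C); first exact: measurableI.
by rewrite !setTI.
Qed.

Lemma sigma_rv_setT d' (T' : measurableType d') (X : T -> T') :
  sigma_rv X setT.
Proof. by exists setT => //; rewrite setTI. Qed.

Lemma sigma_rv_comp d1 d2 (T1 : measurableType d1) (T2 : measurableType d2)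
    (X : T -> T1) (f : T1 -> T2) : measurable_fun setT f ->
  sigma_rv (fun w => f (X w)) `<=` sigma_rv X.
Proof.
move=> mf _ [B mB <-]; exists (f @^-1` B) => //.
by rewrite -[X in measurable X]setTI; exact: mf.
Qed.

Lemma generated_sigma_setI (G : set (set T)) : setI_closed <<s G >>.
Proof. by move=> A B; exact: (@measurableI _ (g_sigma_algebraType G)). Qed.

Lemma generated_sigma_setT (G : set (set T)) : <<s G >> setT.
Proof. exact: (@measurableT _ (g_sigma_algebraType G)). Qed.

(** A whole process is a single sigma-algebra, while claims come in sequences;
    padding by trivial sigma-algebras makes a sequence of it, for use in
    [mutually_independent_sequences]. *)
Lemma mutually_independent_padded (F : set (set T)) : F `<=` measurable ->
  mutually_independent P (fun n : nat => if n == 0%N then F else [set setT]).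
Proof.
move=> mF J E JE.
have ET n : n \in J -> n != 0%N -> E n = setT.
  by move=> nJ n0; have := JE n nJ; rewrite (negbTE n0).
have [J0|J0] := boolP (0%N \in J); last first.
  rewrite bigcap_fset !big1_fset ?probability_setT// => n nJ _.
    by rewrite ET ?probability_setT//; apply: contraNneq J0 => <-.
  by rewrite ET//; apply: contraNneq J0 => <-.
rewrite bigcap_fset !(big_fsetD1 0%N J0)/= [in RHS]big1_fset ?mule1; last first.
  by move=> n /[!inE] /andP[n0 nJ] _; rewrite ET// probability_setT.
rewrite big1_fset ?setIT// => n /[!inE] /andP[n0 nJ] _; exact: ET.
Qed.

(** The instance of [mutually_independent_split] in which the labels name the
    sequences. *)
Lemma mutually_independent_sequences (L : choiceType) (H : L -> set (set T))
    (G : L -> nat -> set (set T)) :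
  (forall a, setI_closed (H a)) -> (forall a, H a setT) ->
  (forall a n, G a n `<=` H a) -> mutually_independent P H ->
  (forall a, mutually_independent P (G a)) ->
  mutually_independent P (fun x : L * nat => G x.1 x.2).
Proof.
move=> HI HT GH indH indG.
apply: (@mutually_independent_split _ _ _ _ _ _ fst _ H) => // a J E JE.
have J2 : {in J &, injective snd}.
  by move=> [b n] [b' n'] /JE[/= -> _] /JE[/= -> _] ->.
have := indG a [fset x.2 | x in J]%fset (fun n => E (a, n)).
rewrite bigcap_fset !big_imfset//=.
have JEa x : x \in J -> (a, x.2) = x by case: x => b n /JE[/= ->].
have -> : \big[setI/setT]_(x <- J) E (a, x.2) = \bigcap_(x in [set` J]) E x.
  by rewrite bigcap_fset; apply: eq_fbigr => x xJ _; rewrite JEa.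
move=> ->; first by apply: eq_fbigr => x xJ _; rewrite JEa.
by move=> _ /imfsetP[x/= xJ ->]; rewrite (JEa x xJ); have [<-] := JE x xJ.
Qed.

End MoreIndependence.

(** The change of time that turns [N0] into a Poisson process with the total
    rate. *)
Lemma poisson_process_scale (R : realType) (d : measure_display)
    (T : measurableType d) (P : probability T R) (la c : R) (N : R -> T -> nat) :
  0 < c -> poisson_process P la N ->
  poisson_process P (c * la) (fun t => N (c * t)).
Proof.
move=> c0 pN; split.
- by move=> t t0; apply: (poisson_process_measurable pN); rewrite mulr_ge0// ltW.
- apply: filterS (poisson_process_path pN) => w [N0 Nhomo Ncts]; split.
  + by rewrite mulr0.
  + by move=> s t s0 st; apply: Nhomo; rewrite ?mulr_ge0 ?ler_pM2l// ltW.
  + move=> t t0; apply: cvg_comp (Ncts (c * t) _); last by rewrite mulr_ge0// ltW.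
    move=> U; rewrite /at_right => U0.
    have cU : \forall s \near t, c * t < c * s -> U (c * s).
      exact: (@mulrl_continuous _ c t _ U0).
    change (\forall s \near t, t < s -> U (c * s)).
    by apply: filterS cU => s /= Us ts; apply: Us; rewrite ltr_pM2l.
- move=> t t0 thomo.
  apply: (poisson_process_independent_increments pN (t := fun i => c * t i)).
    by rewrite mulr_ge0// ltW.
  by move=> i j ij; rewrite ler_pM2l//; exact: thomo.
- move=> s t s0 st k.
  rewrite (poisson_process_increment_law pN) ?mulr_ge0 ?ltr_pM2l// ?ltW//.
  by rewrite -mulrBr mulrA [la * c]mulrC.
Qed.

(** * A marked Poisson process is compound Poisson of type I *)

Lemma sum_fst (R : realType) (I : Type) (r : seq I) (f : I -> R * R) :
  (\sum_(i <- r) f i).1 = \sum_(i <- r) (f i).1.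
Proof. by rewrite (big_morph fst (id1 := 0) (op1 := +%R)). Qed.

Lemma sum_snd (R : realType) (I : Type) (r : seq I) (f : I -> R * R) :
  (\sum_(i <- r) f i).2 = \sum_(i <- r) (f i).2.
Proof. by rewrite (big_morph snd (id1 := 0) (op1 := +%R)). Qed.

Lemma sum_pair_shift (R : realType) (f : nat -> R * R) k :
  (\sum_(1 <= n < k.+1) (f n.-1).1, \sum_(1 <= n < k.+1) (f n.-1).2) =
  \sum_(m < k) f m.
Proof.
by rewrite [RHS]surjective_pairing !big_add1/= !big_mkord sum_fst sum_snd.
Qed.

Section MarkedSequence.
Context (R : realType) (A : finType) (d : measure_display)
  (T : measurableType d) (P : probability T R).
Variables (N : R -> T -> nat) (C : nat -> T -> A)
  (W : A -> nat -> T -> R * R) (lambda : R).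
Hypotheses (poissonN : poisson_process P lambda N)
  (mC : forall m a, measurable (C m @^-1` [set a]))
  (lawC : forall m m' a, P (C m @^-1` [set a]) = P (C m' @^-1` [set a]))
  (mW : forall a l, measurable_fun setT (W a l))
  (indep : mutually_independent P (fun x : unit + (nat + A * nat) =>
     match x with
     | inl _ => sigma_family times N
     | inr (inl m) => preimage_set_system setT (C m) setT
     | inr (inr y) => sigma_rv (W y.1 y.2)
     end))
  (lawW : forall a l l', same_law P (W a l) P (W a l')).

Let F (x : unit + (nat + A * nat)) := match x with
     | inl _ => sigma_family times N
     | inr (inl m) => preimage_set_system setT (C m) setT
     | inr (inr y) => sigma_rv (W y.1 y.2)
     end.

Let mF x : F x `<=` measurable.
Proof.
case: x => [_|[m|y]] /=.
- exact: sigma_family_times_measurable poissonN.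
- by move=> _ [B _ <-]; rewrite setTI; exact: measurable_countable_preimage.
- exact: sub_sigma_rv_measurable.
Qed.

Let FI x : setI_closed (F x).
Proof.
case: x => [_|[m|y]] /=.
- exact: generated_sigma_setI.
- move=> _ _ [B _ <-] [B' _ <-]; exists (B `&` B') => //.
  by rewrite !setTI preimage_setI.
- exact: sigma_rv_setI.
Qed.

Let FT x : F x setT.
Proof.
case: x => [_|[m|y]] /=.
- exact: generated_sigma_setT.
- by exists setT => //; rewrite setTI.
- exact: sigma_rv_setT.
Qed.

Definition marked m (w : T) : R * R := W (C m w) m w.

Lemma measurable_marked m : measurable_fun setT (marked m).
Proof. exact: (measurable_fun_fiberwise (mC m) (f := fun a w => W a m w)). Qed.

Let K (x : unit + nat) := match x with
  | inl _ => sigma_family times N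
  | inr m => sigma_rv (marked m)
  end.

(** Group by the rank [m]: the claim [marked m] is a function of the mark [C m]
    and of the claims [W a m] of all types with this rank. *)
Let indepK : mutually_independent P K.
Proof.
pose g (x : unit + (nat + A * nat)) : unit + nat := match x with
  | inl u => inl u | inr (inl m) => inr m | inr (inr y) => inr y.2 end.
refine (mutually_independentS _ (mutually_independent_group (g := g) (@mF) (@FI) (@FT) indep)).
case=> [u|m] /=.
  by move=> B KB; apply: sub_sigma_algebra; exists (inl u).
move=> _ [B mB <-]; rewrite setTI.
set G := \bigcup_(i in _) _.
have -> : marked m @^-1` B =
    \bigcup_(a in [set: A]) (C m @^-1` [set a] `&` W a m @^-1` B).
  apply/seteqP; split => w /=; first by exists (C m w).
  by case=> a _ [/= <-].
apply: (@fin_bigcup_measurable _ (g_sigma_algebraType G)) => // a _.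
apply: (@measurableI _ (g_sigma_algebraType G)); apply: sub_sigma_algebra.
  by exists (inr (inl m)) => //; exists [set a] => //; rewrite setTI.
by exists (inr (inr (a, m))) => //; exists B => //; rewrite setTI.
Qed.

(** The law is the mixture of the laws of the [W a] with the probabilities of the
    types as weights. *)
Lemma same_law_marked m m' : same_law P (marked m) P (marked m').
Proof.
move=> B mB; have mM l : measurable (marked l @^-1` B).
  by rewrite -[X in measurable X]setTI; exact: measurable_marked.
apply: (eq_probability_fibers (mM m) (mM m') (mC m) (mC m')) => a.
suff H l : P (C l @^-1` [set a] `&` marked l @^-1` B) =
    (P (C 0%N @^-1` [set a]) * P (W a 0%N @^-1` B))%E by rewrite !H.
rewrite (lawC 0%N l) (lawW a 0%N l mB).
pose h (b : bool) : unit + (nat + A * nat) :=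
  if b then inr (inl l) else inr (inr (a, l)).
pose E (b : bool) := if b then C l @^-1` [set a] else W a l @^-1` B.
have hI : injective h by case=> -[].
have := mutually_independent_fin (E := E) indep hI.
rewrite big_bool/= => <-; last first.
  by case; [exists [set a] => //|exists B => //]; rewrite setTI.
congr (P _); apply/seteqP; split => w /=.
  by case=> Ca; rewrite /marked Ca => Bw [].
by move=> H; have := H true; have := H false; rewrite /= /marked => + ->.
Qed.

Lemma compound_poisson_marked d' (T' : measurableType d') (P' : probability T' R)
    (X : R -> T' -> R * R) : 0 < lambda ->
  fdd_equal P' X P (fun t w => \sum_(m < N t w) marked m w) ->
  compound_poisson_type1 P' X.
Proof.
move=> l0 fdd.
exists d, T, P, lambda, N, (fun n w => (marked n.-1 w).1),
  (fun n w => (marked n.-1 w).2).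
have eta n : (fun w => ((marked n w).1, (marked n w).2)) = marked n.
  by apply/funext => w; rewrite -surjective_pairing.
split => //.
- split=> [n|| n].
  + by rewrite /= eta; exact: measurable_marked.
  + rewrite (_ : (fun n : nat => _) = fun n => K (inr n)).
      exact: mutually_independent_inj inr_inj indepK.
    by apply/funext => n; rewrite /= eta.
  + by rewrite /= !eta; exact: same_law_marked.
- pose g (x : unit + nat) : 'I_2 := if x is inl _ then ord0 else lift ord0 ord0.
  have mK x : K x `<=` measurable.
    case: x => [u|m]; first exact: (@mF (inl u)).
    exact/sub_sigma_rv_measurable/measurable_marked.
  have KI x : setI_closed (K x).
    by case: x => [u|m]; [exact: (@FI (inl u))|exact: sigma_rv_setI].
  have KT x : K x setT.
    by case: x => [u|m]; [exact: (@FT (inl u))|exact: sigma_rv_setT].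
  refine (mutually_independentS _ (mutually_independent_group (g := g) (@mK) (@KI) (@KT) indepK)).
  case=> [[|[|//]] i2].
    rewrite (tnth_nth set0)/= => B NB; apply: sub_sigma_algebra.
    by exists (inl tt) => //; exact: val_inj.
  rewrite (tnth_nth set0)/=; apply: sub_sigma_algebra2 => B [[//|n] _ Bn].
  exists (inr n); first exact: val_inj.
  by rewrite /= eta in Bn.
- move=> n t t0 B mB; rewrite (fdd n t t0 B mB); congr (P _).
  congr (_ @^-1` B); apply/funext => w; apply: eq_from_tnth => i.
  by rewrite !tnth_mktuple (sum_pair_shift (fun m => marked m w)).
Qed.

End MarkedSequence.

(** * The three types of claims *)

Section ClaimsByType.
Context (R : realType).

(** Types in the order of the sum [lambda1 + lambda2 + lambda0]: claims
    of [N1], claims of [N2], and common shocks of [N0]. *)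
Definition by_type (X : Type) (x1 x2 x0 : X) (a : 'I_3) : X :=
  match val a with 0%N => x1 | 1%N => x2 | _ => x0 end.

Lemma sum_by_type (V : nmodType) (x1 x2 x0 : V) :
  \sum_a by_type x1 x2 x0 a = x1 + x2 + x0.
Proof. by rewrite !big_ord_recl big_ord0 /= addr0 addrA. Qed.

(** The contribution of one point to the pair of total amounts. Ranks start at 0
    here and at 1 for the claim sizes, whose value of index 0 is 0. *)
Definition claim (T : Type) (Y1 Y2 Y3 Y4 : nat -> T -> R) (a : 'I_3) (l : nat)
    (w : T) : R * R :=
  by_type (Y1 l.+1 w, 0) (0, Y2 l.+1 w) (Y3 l.+1 w, Y4 l.+1 w) a.

Lemma sum_claims (T : Type) (Y1 Y2 Y3 Y4 : nat -> T -> R)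
    (N0 N1 N2 : R -> T -> nat) t w :
  [/\ Y1 0%N w = 0, Y2 0%N w = 0, Y3 0%N w = 0 & Y4 0%N w = 0] ->
  (\sum_(0 <= i < (N1 t w).+1) Y1 i w + \sum_(0 <= i < (N0 t w).+1) Y3 i w,
   \sum_(0 <= i < (N2 t w).+1) Y2 i w + \sum_(0 <= i < (N0 t w).+1) Y4 i w) =
  \sum_a \sum_(l < by_type N1 N2 N0 a t w) claim Y1 Y2 Y3 Y4 a l w.
Proof.
move=> [Y10 Y20 Y30 Y40].
have shift (f : nat -> R) k : f 0%N = 0 ->
    \sum_(0 <= i < k.+1) f i = \sum_(i < k) f i.+1.
  by move=> f0; rewrite big_nat_recl// f0 add0r big_mkord.
rewrite (shift (Y1^~ w))// (shift (Y2^~ w))// (shift (Y3^~ w))// (shift (Y4^~ w))//.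
rewrite !big_ord_recl big_ord0/= addr0 /claim /by_type/=.
rewrite [RHS]surjective_pairing; congr pair.
- rewrite -![(_ + _).1]/(_.1 + _.1) !sum_fst/= [X in _ + (X + _)]big1//.
  by rewrite add0r.
- rewrite -![(_ + _).2]/(_.2 + _.2) !sum_snd/= [X in _ = X + _]big1//.
  by rewrite add0r.
Qed.

Lemma iid_comp d d1 d2 (T : measurableType d) (T1 : measurableType d1)
    (T2 : measurableType d2) (P : probability T R) (X : nat -> T -> T1)
    (f : T1 -> T2) : measurable_fun setT f ->
  iid P X -> iid P (fun n w => f (X n w)).
Proof.
move=> mf [mX indX lawX]; split.
- by move=> n; exact: (measurableT_comp mf).
- by apply: (mutually_independentS _ indX) => n; exact: sigma_rv_comp.
- move=> n B mB.
  have mfB : measurable (f @^-1` B) by rewrite -[X in measurable X]setTI; exact: mf.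
  exact: (lawX n _ mfB).
Qed.

Lemma same_law_comp d d' d1 d2 (T : measurableType d) (T' : measurableType d')
    (T1 : measurableType d1) (T2 : measurableType d2) (P : probability T R)
    (P' : probability T' R) (X : T -> T1) (X' : T' -> T1) (f : T1 -> T2) :
  measurable_fun setT f -> same_law P X P' X' ->
  same_law P (fun w => f (X w)) P' (fun w => f (X' w)).
Proof.
move=> mf lawX B mB.
have mfB : measurable (f @^-1` B) by rewrite -[X in measurable X]setTI; exact: mf.
exact: (lawX _ mfB).
Qed.

Lemma measurable_pair0 : measurable_fun setT (fun x : R => (x, 0 : R)).
Proof. by apply: measurable_fun_pair. Qed.

Lemma measurable_0pair : measurable_fun setT (fun x : R => (0 : R, x)).
Proof. by apply: measurable_fun_pair. Qed.

Section ClaimSizes.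
Context d (T : measurableType d) (P : probability T R).
Variables (Y1 Y2 Y3 Y4 : nat -> T -> R).
Hypothesis claimsY : claim_sizes P Y1 Y2 Y3 Y4.

Definition sigma_claims (a : 'I_3) : set (set T) :=
  by_type (sigma_family positive_indices Y1) (sigma_family positive_indices Y2)
    (sigma_family positive_indices (fun i w => (Y3 i w, Y4 i w))) a.

Lemma sigma_rv_claim a l :
  sigma_rv (claim Y1 Y2 Y3 Y4 a l) `<=` sigma_claims a.
Proof.
case: a => [[|[|[|//]]] ia] B.
- move=> /(sigma_rv_comp measurable_pair0) H.
  by apply: sub_sigma_algebra; exists l.+1.
- move=> /(sigma_rv_comp measurable_0pair) H.
  by apply: sub_sigma_algebra; exists l.+1.
- by move=> H; apply: sub_sigma_algebra; exists l.+1.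
Qed.

Lemma iid_claim a : iid P (claim Y1 Y2 Y3 Y4 a).
Proof.
case: claimsY => _ iid1 iid2 iid34 _.
case: a => [[|[|[|//]]] ia].
- exact: (iid_comp measurable_pair0 iid1).
- exact: (iid_comp measurable_0pair iid2).
- exact: iid34.
Qed.

Lemma measurable_claim a l : measurable_fun setT (claim Y1 Y2 Y3 Y4 a l).
Proof. by have [mX _ _] := iid_claim a. Qed.

Lemma same_law_claim a l l' :
  same_law P (claim Y1 Y2 Y3 Y4 a l) P (claim Y1 Y2 Y3 Y4 a l').
Proof. by have [_ _ law] := iid_claim a; move=> B mB; rewrite !law. Qed.

End ClaimSizes.

Lemma same_law_claims d d' (T : measurableType d) (T' : measurableType d')
    (P : probability T R) (P' : probability T' R)
    (Y1 Y2 Y3 Y4 : nat -> T -> R) (Z1 Z2 Z3 Z4 : nat -> T' -> R) :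
  claim_sizes P Y1 Y2 Y3 Y4 -> claim_sizes P' Z1 Z2 Z3 Z4 ->
  same_law P (Y1 1%N) P' (Z1 1%N) -> same_law P (Y2 1%N) P' (Z2 1%N) ->
  same_law P (fun w => (Y3 1%N w, Y4 1%N w)) P' (fun w => (Z3 1%N w, Z4 1%N w)) ->
  forall a l l', same_law P (claim Y1 Y2 Y3 Y4 a l) P' (claim Z1 Z2 Z3 Z4 a l').
Proof.
move=> cY cZ law1 law2 law34 a l l' B mB.
rewrite (same_law_claim cY a l 0%N mB) (same_law_claim cZ a l' 0%N mB).
move: B mB; case: a => [[|[|[|//]]] ia].
- exact: (same_law_comp measurable_pair0 law1).
- exact: (same_law_comp measurable_0pair law2).
- exact: law34.
Qed.

End ClaimsByType.

(** * Independence of increments, marks and claims *)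

Section IndependentClaims.
Context (R : realType) (d : measure_display) (T : measurableType d)
  (P : probability T R).
Variables (N0 N1 N2 : R -> T -> nat) (Y1 Y2 Y3 Y4 : nat -> T -> R).
Hypothesis claimsY : claim_sizes P Y1 Y2 Y3 Y4.

Section Superposed.
Variables (lambda : 'I_3 -> R).
Hypothesis pN : forall a, poisson_process P (lambda a) (by_type N1 N2 N0 a).
Hypothesis indep : independent_list P
  [:: sigma_family times N0; sigma_family times N1; sigma_family times N2;
      sigma_family positive_indices Y1; sigma_family positive_indices Y2;
      sigma_family positive_indices (fun i w => (Y3 i w, Y4 i w))].

Let source (x : 'I_3 + 'I_3) : set (set T) := match x with
  | inl a => sigma_family times (by_type N1 N2 N0 a)
  | inr a => sigma_claims Y1 Y2 Y3 Y4 a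
  end.

Let indep_source : mutually_independent P source.
Proof.
pose h (x : 'I_3 + 'I_3) : 'I_6 := match x with
  | inl a => by_type (@Ordinal 6 1 isT) (@Ordinal 6 2 isT) (@Ordinal 6 0 isT) a
  | inr a => by_type (@Ordinal 6 3 isT) (@Ordinal 6 4 isT) (@Ordinal 6 5 isT) a
  end.
have hI : injective h.
  by move=> [] [[|[|[|//]]] i] [] [[|[|[|//]]] j] //= _; congr (_ _); exact: val_inj.
have := mutually_independent_inj hI indep.
congr (mutually_independent P _); apply/funext => x.
by rewrite (tnth_nth set0); case: x => -[[|[|[|//]]] i].
Qed.

(** The six independent sigma-algebras of the hypothesis are refined into their
    individual members: the claims one by one, and any independent sequence [G a]
    of variables read off the process of type [a]. *)
Lemma independent_atoms (G : 'I_3 -> nat -> set (set T)) :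
  (forall a n, G a n `<=` sigma_family times (by_type N1 N2 N0 a)) ->
  (forall a, mutually_independent P (G a)) ->
  mutually_independent P (fun x : ('I_3 + 'I_3) * nat => match x.1 with
    | inl a => G a x.2
    | inr a => sigma_rv (claim Y1 Y2 Y3 Y4 a x.2)
    end).
Proof.
move=> GN indG; refine (@mutually_independent_sequences _ _ _ P _ source
  (fun y n => match y with
    | inl a => G a n
    | inr a => sigma_rv (claim Y1 Y2 Y3 Y4 a n)
    end) _ _ _ indep_source _).
- by case=> -[[|[|[|//]]] i]; exact: generated_sigma_setI.
- by case=> -[[|[|[|//]]] i]; exact: generated_sigma_setT.
- by case=> a n; [exact: GN|exact: sigma_rv_claim].
- by case=> a; [exact: indG|have [] := iid_claim claimsY a].
Qed.

Lemma superposition_independent :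
  mutually_independent P (fun x : 'I_3 + 'I_3 * nat => match x with
    | inl a => sigma_family times (by_type N1 N2 N0 a)
    | inr y => sigma_rv (claim Y1 Y2 Y3 Y4 y.1 y.2)
    end).
Proof.
pose G a (n : nat) :=
  if n == 0%N then sigma_family times (by_type N1 N2 N0 a) else [set setT].
have GS a n : G a n `<=` sigma_family times (by_type N1 N2 N0 a).
  by rewrite /G; case: ifP => _ B //= ->; exact: generated_sigma_setT.
have indG a := mutually_independent_padded P (sigma_family_times_measurable (pN a)).
pose h (x : 'I_3 + 'I_3 * nat) : ('I_3 + 'I_3) * nat := match x with
  | inl a => (inl a, 0%N)
  | inr y => (inr y.1, y.2) end.
have hI : injective h by move=> [a|[a n]] [b|[b m]] //= [-> // ->].
have := mutually_independent_inj hI (independent_atoms GS indG).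
by congr (mutually_independent P _); apply/funext => -[].
Qed.

End Superposed.

(** The marks are functions [C n] of the indicator vectors [I n.+1], so their
    independence from the Poisson process and the claims is inherited. As in
    [superposition_independent], the process is one atom, placed at rank 0 of a
    sequence of otherwise trivial atoms. *)
Lemma thinning_independent (N : R -> T -> nat) (I : nat -> T -> R * R * R)
    (C : nat -> T -> 'I_3) (lambda : R) :
  poisson_process P lambda N ->
  mutually_independent P (fun n => sigma_rv (I n.+1)) ->
  (forall n, preimage_set_system setT (C n) setT `<=` sigma_rv (I n.+1)) ->
  independent_list P
    [:: sigma_family times N;
        sigma_family positive_indices Y1; sigma_family positive_indices Y2;
        sigma_family positive_indices (fun i w => (Y3 i w, Y4 i w));
        sigma_family positive_indices I] ->
  mutually_independent P (fun x : unit + (nat + 'I_3 * nat) => match x with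
    | inl _ => sigma_family times N
    | inr (inl m) => preimage_set_system setT (C m) setT
    | inr (inr y) => sigma_rv (claim Y1 Y2 Y3 Y4 y.1 y.2)
    end).
Proof.
move=> pN indI CI indep.
pose source (x : bool + 'I_3) : set (set T) := match x with
  | inl b => if b then sigma_family times N else sigma_family positive_indices I
  | inr a => sigma_claims Y1 Y2 Y3 Y4 a
  end.
have indep_source : mutually_independent P source.
  pose h (x : bool + 'I_3) : 'I_5 := match x with
    | inl b => if b then @Ordinal 5 0 isT else @Ordinal 5 4 isT
    | inr a => by_type (@Ordinal 5 1 isT) (@Ordinal 5 2 isT) (@Ordinal 5 3 isT) a
    end.
  have hI : injective h.
    move=> [[]|[[|[|[|//]]] i]] [[]|[[|[|[|//]]] j]] //= _; congr (_ _); exact: val_inj.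
  have := mutually_independent_inj hI indep.
  congr (mutually_independent P _); apply/funext => x.
  by rewrite (tnth_nth set0); case: x => [[]|[[|[|[|//]]] i]].
pose G (y : bool + 'I_3) (n : nat) := match y with
    | inl true => if n == 0%N then sigma_family times N else [set setT]
    | inl false => sigma_rv (I n.+1)
    | inr a => sigma_rv (claim Y1 Y2 Y3 Y4 a n)
    end.
have : mutually_independent P (fun x : (bool + 'I_3) * nat => G x.1 x.2).
  refine (mutually_independent_sequences _ _ _ indep_source _).
  - by case=> [[]|[[|[|[|//]]] i]]; exact: generated_sigma_setI.
  - by case=> [[]|[[|[|[|//]]] i]]; exact: generated_sigma_setT.
  - case=> [[]|a] n /=.
    + by case: ifP => _ B //= ->; exact: generated_sigma_setT.
    + by move=> B IB; apply: sub_sigma_algebra; exists n.+1.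
    + exact: sigma_rv_claim.
  - case=> [[]|a].
    + exact: (mutually_independent_padded P (sigma_family_times_measurable pN)).
    + exact: indI.
    + by have [] := iid_claim claimsY a.
pose h (x : unit + (nat + 'I_3 * nat)) : (bool + 'I_3) * nat := match x with
  | inl _ => (inl true, 0%N)
  | inr (inl m) => (inl false, m)
  | inr (inr y) => (inr y.1, y.2) end.
have hI : injective h.
  by move=> [[]|[m|[a n]]] [[]|[m'|[a' n']]] //= [-> // ->].
move=> /(mutually_independent_inj hI) ind.
refine (mutually_independentS _ ind).
by move=> [[]|[m|[a n]]] //=; exact: CI.
Qed.

End IndependentClaims.

(** * Types given by indicator vectors *)

Lemma ord3P (Q : 'I_3 -> Prop) :
  Q (inord 0) -> Q (inord 1) -> Q (inord 2) -> forall a, Q a.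
Proof.
by move=> Q0 Q1 Q2 a; rewrite -(inord_val a); case: a => [[|[|[|//]]] i].
Qed.

Lemma sum_ord3 (V : nmodType) (q : 'I_3 -> V) :
  \sum_a q a = q (inord 0) + q (inord 1) + q (inord 2).
Proof.
rewrite !big_ord_recl big_ord0 addr0 addrA.
by congr (q _ + q _ + q _); apply: val_inj; rewrite /= inordK.
Qed.

Lemma by_typeE (X : Type) (x1 x2 x0 : X) :
  (by_type x1 x2 x0 (inord 0) = x1) * (by_type x1 x2 x0 (inord 1) = x2) *
  (by_type x1 x2 x0 (inord 2) = x0).
Proof. by rewrite /by_type/= !inordK. Qed.

Section Marks.
Context (R : realType).

Definition unit_mark : 'I_3 -> R * R * R := by_type (1, 0, 0) (0, 1, 0) (0, 0, 1).

(** The vectors which are not unit vectors are given the last type; they form a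
    null set ([ae_unit_mark]). *)
Definition mark (x : R * R * R) : 'I_3 :=
  if x == unit_mark (inord 0) then inord 0
  else if x == unit_mark (inord 1) then inord 1 else inord 2.

Lemma mark_unit a : mark (unit_mark a) = a.
Proof.
by elim/ord3P: a; rewrite /mark /unit_mark !by_typeE !xpair_eqE ?eqxx
  ?(eq_sym 0) ?oner_eq0.
Qed.

Lemma mark_unit_eq a x : val a != 2%N -> mark x = a -> x = unit_mark a.
Proof.
rewrite /mark => a2; case: eqP => [-> <-//|_]; case: eqP => [-> <-//|_] a2'.
by move: a2; rewrite -a2' /= inordK.
Qed.

Lemma measurable_unit_mark a : measurable [set unit_mark a].
Proof.
have m1 d1 d2 (T1 : measurableType d1) (T2 : measurableType d2) (x : T1) (y : T2) :
    measurable [set x] -> measurable [set y] -> measurable [set (x, y)].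
  move=> mx my; rewrite (_ : [set (x, y)] = [set x] `*` [set y]).
    exact: measurableX.
  by apply/seteqP; split => -[u v] /=; [case=> -> ->|case=> -> ->].
by elim/ord3P: a; rewrite /unit_mark by_typeE; apply: (m1 _ _ (R * R)%type R) => //; exact: m1.
Qed.

Lemma mark_preimage2 : mark @^-1` [set inord 2] =
  ~` ([set unit_mark (inord 0)] `|` [set unit_mark (inord 1)]).
Proof.
have ne k l : (k < 3)%N -> (l < 3)%N -> k != l -> inord k <> inord l :> 'I_3.
  by move=> k3 l3 kl /(congr1 val)/=; rewrite !inordK// => /eqP; exact/negP.
apply/seteqP; split => x /=.
  by move=> x2 [xE|xE]; move: x2; rewrite xE mark_unit; exact: ne.
move=> x01; rewrite /mark; case: eqP => [x0|_]; first by case: x01; left.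
by case: eqP => [x1|//]; case: x01; right.
Qed.

Lemma mark_preimage a : val a != 2%N -> mark @^-1` [set a] = [set unit_mark a].
Proof.
move=> a2; apply/seteqP; split => x /=; first exact: mark_unit_eq.
by move=> ->; exact: mark_unit.
Qed.

Lemma measurable_mark_preimage B : measurable (mark @^-1` B).
Proof.
apply: (@measurable_countable_preimage _ (R * R * R)%type) => a.
have [a2|a2] := eqVneq (val a) 2%N; last first.
  by rewrite mark_preimage//; exact: measurable_unit_mark.
have -> : a = inord 2 by rewrite -(inord_val a) a2.
rewrite mark_preimage2; apply/measurableC/measurableU; exact: measurable_unit_mark.
Qed.

Context d (T : measurableType d) (P : probability T R).
Variables (I : T -> R * R * R) (q : 'I_3 -> R).
Hypotheses (mI : measurable_fun setT I) (sumq : \sum_a q a = 1)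
  (lawI : forall a, P (I @^-1` [set unit_mark a]) = (q a)%:E).

Let mIB B : measurable B -> measurable (I @^-1` B).
Proof. by move=> mB; rewrite -[X in measurable X]setTI; exact: mI. Qed.

(** The last type gets what the two others leave, and the three probabilities
    add up to 1. *)
Lemma law_mark a : P ((mark \o I) @^-1` [set a]) = (q a)%:E.
Proof.
rewrite comp_preimage.
have [a2|a2] := eqVneq (val a) 2%N; last by rewrite mark_preimage.
have -> : a = inord 2 by rewrite -(inord_val a) a2.
rewrite mark_preimage2 -preimage_setC probability_setC; last first.
  by apply: mIB; apply: measurableU; exact: measurable_unit_mark.
have -> : P (I @^-1` ([set unit_mark (inord 0)] `|` [set unit_mark (inord 1)])) =
    (P (I @^-1` [set unit_mark (inord 0)]) + P (I @^-1` [set unit_mark (inord 1)]))%E.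
  rewrite preimage_setU; apply: measureU.
  - by apply: mIB; exact: measurable_unit_mark.
  - by apply: mIB; exact: measurable_unit_mark.
  - rewrite -subset0 => w [/= I0 I1].
    have /(congr1 val) := mark_unit (inord 0).
    by rewrite -I0 I1 mark_unit /= !inordK.
rewrite !lawI -EFinD -[LHS]/(1 - (q (inord 0) + q (inord 1)))%:E; congr (_%:E).
by apply/eqP; rewrite subr_eq -sumq sum_ord3 addrC.
Qed.

(** The event that the mark is the last type contains the event that [I] is the
    last unit vector, and both have the same probability. *)
Lemma ae_unit_mark : {ae P, forall w, I w = unit_mark (mark (I w))}.
Proof.
pose N := ((mark \o I) @^-1` [set inord 2]) `\` (I @^-1` [set unit_mark (inord 2)]).
have m2 : measurable ((mark \o I) @^-1` [set inord 2]).
  by rewrite comp_preimage; apply: mIB; exact: measurable_mark_preimage.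
have mu2 : measurable (I @^-1` [set unit_mark (inord 2)]).
  by apply: mIB; exact: measurable_unit_mark.
exists N; split; first exact: measurableD.
  have -> : P N = (P ((mark \o I) @^-1` [set inord 2]) -
      P ((mark \o I) @^-1` [set inord 2] `&` I @^-1` [set unit_mark (inord 2)]))%E.
    by apply: measureD => //; rewrite [X in (X < _)%E]law_mark ltry.
  rewrite setIidr; last by move=> w /= ->; rewrite mark_unit.
  by rewrite law_mark lawI subee.
move=> w /= neq; have [m2w|m2w] := eqVneq (val (mark (I w))) 2%N; last first.
  by case: neq; exact: mark_unit_eq.
have mE : mark (I w) = inord 2 by rewrite -(inord_val (mark _)) m2w.
by split => //= IE; apply: neq; rewrite mE.
Qed.

End Marks.

(** * Marks made from empty cells of Poisson processes *)

Section EmptyGrid.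
Context (R : realType).

(** A cell of length [- ln p / l] has no point of a Poisson process with rate [l]
    with probability [expR (ln p) = p]. *)
Definition empty_grid (p l : R) (j : nat) : R := j%:R * (- ln p / l).

Lemma empty_grid0 p l : empty_grid p l 0 = 0.
Proof. exact: mul0r. Qed.

Lemma empty_grid_homo (p l : R) : 0 < p < 1 -> 0 < l ->
  {homo empty_grid p l : i j / (i <= j)%N >-> i <= j}.
Proof.
move=> pb l0 i j ij; rewrite /empty_grid ler_wpM2r ?ler_nat//.
apply: divr_ge0; last exact: ltW.
by rewrite oppr_ge0 ltW// ln_lt0.
Qed.

Lemma probability_empty d (T : measurableType d) (P : probability T R)
    (p l : R) (N : R -> T -> nat) m :
  0 < p < 1 -> 0 < l -> poisson_process P l N ->
  P [set w | increment N (empty_grid p l) m w = 0%N] = p%:E.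
Proof.
move=> pb l0 pN.
rewrite (poisson_increment l0 pN (empty_grid0 p l) (empty_grid_homo pb l0)).
rewrite /poisson_weight expr0 fact0 divr1 mul1r /empty_grid -mulrBl.
rewrite -natrB ?leqnSn// subSnn mul1r mulrC divfK ?gt_eqF// opprK lnK//.
by case/andP: pb.
Qed.

End EmptyGrid.

Section MarksFromIncrements.
Context (R : realType) (d : measure_display) (T : measurableType d)
  (P : probability T R).
Variables (N0 N1 N2 : R -> T -> nat) (Y1 Y2 Y3 Y4 : nat -> T -> R)
  (lambda : 'I_3 -> R).
Hypotheses (claimsY : claim_sizes P Y1 Y2 Y3 Y4)
  (lambda_gt0 : forall a, 0 < lambda a)
  (pN : forall a, poisson_process P (lambda a) (by_type N1 N2 N0 a)).
Hypothesis indep : independent_list P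
  [:: sigma_family times N0; sigma_family times N1; sigma_family times N2;
      sigma_family positive_indices Y1; sigma_family positive_indices Y2;
      sigma_family positive_indices (fun i w => (Y3 i w, Y4 i w))].

(** The type of [N1] is chosen if the cell of [N1] is empty, with probability
    [p1]. If not, the type of [N2] is chosen if the cell of [N2] is empty, so
    [p2] is the conditional probability of this type given that the first one is
    not chosen. *)
Let p1 : R := lambda (inord 0) / \sum_a lambda a.
Let p2 : R := lambda (inord 1) / (lambda (inord 1) + lambda (inord 2)).
Let tau1 := empty_grid p1 (lambda (inord 0)).
Let tau2 := empty_grid p2 (lambda (inord 1)).

Let p1_bounds : 0 < p1 < 1.
Proof.
have S0 : 0 < \sum_a lambda a by rewrite sum_ord3 !addr_gt0.
rewrite /p1 divr_gt0//= ltr_pdivrMr// mul1r sum_ord3 -addrA.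
by rewrite ltrDl addr_gt0.
Qed.

Let p2_bounds : 0 < p2 < 1.
Proof. by rewrite /p2 divr_gt0 ?addr_gt0//= ltr_pdivrMr ?addr_gt0// mul1r ltrDl. Qed.

Let empty1 m := [set w | increment N1 tau1 m w = 0%N].
Let empty2 m := [set w | increment N2 tau2 m w = 0%N].

Let pN1 : poisson_process P (lambda (inord 0)) N1.
Proof. by have := pN (inord 0); rewrite by_typeE. Qed.

Let pN2 : poisson_process P (lambda (inord 1)) N2.
Proof. by have := pN (inord 1); rewrite by_typeE. Qed.

Let tau1_homo := empty_grid_homo p1_bounds (lambda_gt0 (inord 0)).
Let tau2_homo := empty_grid_homo p2_bounds (lambda_gt0 (inord 1)).

Definition increment_mark m (w : T) : 'I_3 :=
  if increment N1 tau1 m w == 0%N then inord 0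
  else if increment N2 tau2 m w == 0%N then inord 1 else inord 2.

Let increment_mark_preimage m B : increment_mark m @^-1` B =
  (if pselect (B (inord 0)) then empty1 m else set0) `|`
  ((if pselect (B (inord 1)) then ~` empty1 m `&` empty2 m else set0) `|`
   (if pselect (B (inord 2)) then ~` empty1 m `&` ~` empty2 m else set0)).
Proof.
apply/seteqP; split => w; rewrite /increment_mark /empty1 /empty2 /preimage/=.
  case: eqP => [w1|w1]; first by move=> B0; left; case: pselect.
  case: eqP => [w2|w2] => [B1|B2]; right.
    by left; case: pselect.
  by right; case: pselect.
case; first by case: pselect => //= B0 ->; rewrite eqxx.
case; case: pselect => //= B' [].
  by move=> /eqP/negbTE -> ->; rewrite eqxx.
by move=> /eqP/negbTE -> /eqP/negbTE ->.
Qed.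

Let increment_mark_sigma (H : set (set T)) m B :
  <<s H >> (empty1 m) -> <<s H >> (empty2 m) ->
  <<s H >> (increment_mark m @^-1` B).
Proof.
move=> m1 m2; rewrite increment_mark_preimage.
have mH (Q : Prop) (X : set T) : <<s H >> X ->
    <<s H >> (if pselect Q then X else set0).
  move=> mX; case: (pselect Q) => [//|_] /=.
  exact: (@measurable0 _ (g_sigma_algebraType H)).
apply: (@measurableU _ (g_sigma_algebraType H)); first exact: mH.
apply: (@measurableU _ (g_sigma_algebraType H)); apply: mH;
  apply: (@measurableI _ (g_sigma_algebraType H)) => //;
  exact: (@measurableC _ (g_sigma_algebraType H)).
Qed.

Let measurable_empty1 m : measurable (empty1 m).
Proof.
apply: (sigma_family_times_measurable pN1).
exact: (sigma_family_increment (empty_grid0 _ _) tau1_homo).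
Qed.

Let measurable_empty2 m : measurable (empty2 m).
Proof.
apply: (sigma_family_times_measurable pN2).
exact: (sigma_family_increment (empty_grid0 _ _) tau2_homo).
Qed.

Lemma measurable_increment_mark m a : measurable (increment_mark m @^-1` [set a]).
Proof.
rewrite -[measurable](sigma_algebra_id (@sigma_algebra_measurable _ T)).
apply: increment_mark_sigma; apply: sub_sigma_algebra.
  exact: measurable_empty1.
exact: measurable_empty2.
Qed.

(** The sequences refined from the three processes: increments of [N1] and [N2]
    over the cells of their grids, and [N0] as a whole. *)
Let G a (n : nat) : set (set T) :=
  by_type (sigma_rv (increment N1 tau1 n)) (sigma_rv (increment N2 tau2 n))
    (if n == 0%N then sigma_family times N0 else [set setT]) a.

Let indep_increments l N tau : tau 0%N = 0 ->
  {homo tau : i j / (i <= j)%N >-> i <= j} -> poisson_process P l N ->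
  mutually_independent P (fun n => sigma_rv (increment N tau n)).
Proof.
move=> tau0 tau_homo pNl.
by apply: (poisson_process_independent_increments pNl) => //; rewrite tau0.
Qed.

Let atoms : mutually_independent P (fun x : ('I_3 + 'I_3) * nat => match x.1 with
    | inl a => G a x.2
    | inr a => sigma_rv (claim Y1 Y2 Y3 Y4 a x.2)
    end).
Proof.
apply: (independent_atoms claimsY indep) => a.
  elim/ord3P: a => n; rewrite /G !by_typeE.
  - exact: (sigma_rv_increment (empty_grid0 _ _) tau1_homo).
  - exact: (sigma_rv_increment (empty_grid0 _ _) tau2_homo).
  - by case: ifP => _ B //= ->; exact: generated_sigma_setT.
elim/ord3P: a; rewrite /G.
- under eq_fun do rewrite by_typeE; exact: (indep_increments (empty_grid0 _ _) tau1_homo pN1).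
- under eq_fun do rewrite by_typeE; exact: (indep_increments (empty_grid0 _ _) tau2_homo pN2).
- under eq_fun do rewrite by_typeE.
  have := sigma_family_times_measurable (pN (inord 2)); rewrite by_typeE.
  exact: mutually_independent_padded.
Qed.

(** The cells of [N1] and [N2] are independent, so the three probabilities are
    [p1], [(1 - p1) * p2] and [(1 - p1) * (1 - p2)]. *)
Lemma increment_mark_law m a :
  P (increment_mark m @^-1` [set a]) = (lambda a / \sum_b lambda b)%:E.
Proof.
pose h (b : bool) : ('I_3 + 'I_3) * nat :=
  (inl (if b then inord 0 else inord 1), m).
have ne k l : (k < 3)%N -> (l < 3)%N -> k != l -> (inord k == inord l :> 'I_3) = false.
  by move=> k3 l3 kl; apply/eqP => /(congr1 val)/=; rewrite !inordK// => /eqP; exact/negP.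
have hI : injective h by move=> [] [] // [] /eqP; rewrite ne.
have PE (E : bool -> set T) : sigma_rv (increment N1 tau1 m) (E true) ->
    sigma_rv (increment N2 tau2 m) (E false) ->
    P (E true `&` E false) = (P (E true) * P (E false))%E.
  move=> E1 E2; have := mutually_independent_fin (E := E) atoms hI.
  rewrite big_bool/= => <-; last by case; rewrite /G/= by_typeE.
  by congr (P _); apply/seteqP; split => w /= => [[H1 H2] []//|H].
have s1 B : sigma_rv (increment N1 tau1 m) (increment N1 tau1 m @^-1` B).
  by exists B => //; rewrite setTI.
have s2 B : sigma_rv (increment N2 tau2 m) (increment N2 tau2 m @^-1` B).
  by exists B => //; rewrite setTI.
have Pe1 : P (empty1 m) = p1%:E by exact: (probability_empty _ p1_bounds _ pN1).
have Pe2 : P (empty2 m) = p2%:E by exact: (probability_empty _ p2_bounds _ pN2).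
have S0 : \sum_a lambda a != 0 by rewrite gt_eqF// sum_ord3 !addr_gt0.
have S12 : lambda (inord 1) + lambda (inord 2) != 0 by rewrite gt_eqF// addr_gt0.
have dec (b : bool) (Q : Prop) : reflect Q b -> forall S1 S2 : set T,
    (if pselect Q then S1 else S2) = if b then S1 else S2.
  by move=> r S1 S2; case: r => q; case: pselect.
rewrite increment_mark_preimage !(dec _ _ eqP).
elim/ord3P: a; rewrite !eqxx !ne// ?set0U ?setU0.
- by rewrite Pe1.
- rewrite (PE (fun b => if b then ~` empty1 m else empty2 m)); last 2 first.
  + exact: (s1 (~` [set 0%N])).
  + exact: (s2 [set 0%N]).
  rewrite /= probability_setC// Pe1 Pe2 -[LHS]/((1 - p1) * p2)%:E; congr (_%:E).
  by rewrite /p1 /p2 sum_ord3 in S0 *; field; rewrite S0 S12.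
- rewrite (PE (fun b => if b then ~` empty1 m else ~` empty2 m)); last 2 first.
  + exact: (s1 (~` [set 0%N])).
  + exact: (s2 (~` [set 0%N])).
  rewrite /= !probability_setC// Pe1 Pe2 -[LHS]/((1 - p1) * (1 - p2))%:E; congr (_%:E).
  by rewrite /p1 /p2 sum_ord3 in S0 *; field; rewrite S0 S12.
Qed.

(** The mark of rank [m] is a function of the [m]-th cells of [N1] and [N2]: group
    these two, for every [m], and leave [N0] and the claims as they are. *)
Lemma increment_mark_independent (c : R) : 0 < c ->
  mutually_independent P (fun x : unit + (nat + 'I_3 * nat) => match x with
    | inl _ => sigma_family times (fun t => N0 (c * t))
    | inr (inl m) => preimage_set_system setT (increment_mark m) setT
    | inr (inr y) => sigma_rv (claim Y1 Y2 Y3 Y4 y.1 y.2)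
    end).
Proof.
move=> c0.
pose F (x : ('I_3 + 'I_3) * nat) := match x.1 with
    | inl a => G a x.2
    | inr a => sigma_rv (claim Y1 Y2 Y3 Y4 a x.2)
    end.
pose g (x : ('I_3 + 'I_3) * nat) : unit + (nat + 'I_3 * nat) := match x.1 with
    | inl a => by_type (inr (inl x.2)) (inr (inl x.2)) (inl tt) a
    | inr a => inr (inr (a, x.2))
    end.
have pN0 : poisson_process P (lambda (inord 2)) N0.
  by have := pN (inord 2); rewrite by_typeE.
have mI l N tau n : poisson_process P l N -> tau 0%N = 0 ->
    {homo tau : i j / (i <= j)%N >-> i <= j} ->
    sigma_rv (increment N tau n) `<=` measurable.
  move=> pNl tau0 tau_homo B HB; apply: (sigma_family_times_measurable pNl).
  exact: (sigma_rv_increment tau0 tau_homo HB).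
have mF x : F x `<=` measurable.
  case: x => [[a|a] n]; rewrite /F/=; last first.
    exact/sub_sigma_rv_measurable/(measurable_claim claimsY).
  elim/ord3P: a; rewrite /G by_typeE.
  - exact: (mI _ _ _ _ pN1 (empty_grid0 _ _) tau1_homo).
  - exact: (mI _ _ _ _ pN2 (empty_grid0 _ _) tau2_homo).
  - by case: ifP => _ B; [exact: (sigma_family_times_measurable pN0)|move=> ->].
have FI x : setI_closed (F x).
  case: x => [[a|a] n]; rewrite /F/=; last exact: sigma_rv_setI.
  elim/ord3P: a; rewrite /G by_typeE; try exact: sigma_rv_setI.
  by case: ifP => _ B D; [exact: generated_sigma_setI|move=> -> ->; rewrite /= setIT].
have FT x : F x setT.
  case: x => [[a|a] n]; rewrite /F/=; last exact: sigma_rv_setT.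
  elim/ord3P: a; rewrite /G by_typeE; try exact: sigma_rv_setT.
  by case: ifP => _ //; exact: generated_sigma_setT.
refine (mutually_independentS _
  (mutually_independent_group (g := g) (@mF) (@FI) (@FT) atoms)).
move=> [u|[m|[a n]]].
- apply: sub_sigma_algebra2 => _ [t /= t0 [B mB <-]].
  exists (inl (inord 2), 0%N); first by rewrite /g /= by_typeE; case: u.
  rewrite /F /G /= by_typeE; apply: sub_sigma_algebra; exists (c * t).
    by rewrite /= mulr_ge0// ltW.
  by exists B.
- move=> _ [B _ <-]; rewrite setTI.
  apply: increment_mark_sigma; apply: sub_sigma_algebra.
    exists (inl (inord 0), m); first by rewrite /g /= by_typeE.
    by rewrite /F /G /= by_typeE; exists [set 0%N] => //; rewrite setTI.
  exists (inl (inord 1), m); first by rewrite /g /= by_typeE.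
  by rewrite /F /G /= by_typeE; exists [set 0%N] => //; rewrite setTI.
- by move=> B HB; apply: sub_sigma_algebra; exists (inr a, n).
Qed.

End MarksFromIncrements.

(** * The bivariate total claim amount process *)

Theorem theorem3 (R : realType) (d : measure_display) (T : measurableType d)
    (P : probability T R) (lambda0 lambda1 lambda2 : R)
    (N0 N1 N2 : R -> T -> nat) (Y1 Y2 Y3 Y4 : nat -> T -> R) :
  0 < lambda0 -> 0 < lambda1 -> 0 < lambda2 ->
  poisson_process P lambda0 N0 ->
  poisson_process P lambda1 N1 ->
  poisson_process P lambda2 N2 ->
  claim_sizes P Y1 Y2 Y3 Y4 ->
  independent_list P
    [:: sigma_family times N0; sigma_family times N1; sigma_family times N2;
        sigma_family positive_indices Y1;
        sigma_family positive_indices Y2;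
        sigma_family positive_indices (fun i w => (Y3 i w, Y4 i w))] ->
  let S1 (t : R) (w : T) :=
    \sum_(0 <= i < (N1 t w).+1) Y1 i w + \sum_(0 <= i < (N0 t w).+1) Y3 i w in
  let S2 (t : R) (w : T) :=
    \sum_(0 <= i < (N2 t w).+1) Y2 i w + \sum_(0 <= i < (N0 t w).+1) Y4 i w in
  compound_poisson_type1 P (fun t w => (S1 t w, S2 t w)) /\
  forall (d' : measure_display) (T' : measurableType d')
    (P' : probability T' R) (N : R -> T' -> nat)
    (Z1 Z2 Z3 Z4 : nat -> T' -> R) (I1 I2 I0 : nat -> T' -> R),
  let lambda := lambda1 + lambda2 + lambda0 in
  poisson_process P' lambda N ->
  claim_sizes P' Z1 Z2 Z3 Z4 ->
  same_law P (Y1 1%N) P' (Z1 1%N) ->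
  same_law P (Y2 1%N) P' (Z2 1%N) ->
  same_law P (fun w => (Y3 1%N w, Y4 1%N w)) P' (fun w => (Z3 1%N w, Z4 1%N w)) ->
  (forall w, [/\ I1 0%N w = 0, I2 0%N w = 0 & I0 0%N w = 0]) ->
  iid P' (fun i w => (I1 i.+1 w, I2 i.+1 w, I0 i.+1 w)) ->
  P' [set w | [/\ I1 1%N w = 1, I2 1%N w = 0 & I0 1%N w = 0]] =
    (lambda1 / lambda)%:E ->
  P' [set w | [/\ I1 1%N w = 0, I2 1%N w = 1 & I0 1%N w = 0]] =
    (lambda2 / lambda)%:E ->
  P' [set w | [/\ I1 1%N w = 0, I2 1%N w = 0 & I0 1%N w = 1]] =
    (lambda0 / lambda)%:E ->
  independent_list P'
    [:: sigma_family times N;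
        sigma_family positive_indices Z1;
        sigma_family positive_indices Z2;
        sigma_family positive_indices (fun i w => (Z3 i w, Z4 i w));
        sigma_family positive_indices (fun i w => (I1 i w, I2 i w, I0 i w))] ->
  let S3 (t : R) (w : T') :=
    \sum_(0 <= n < (N t w).+1) (I1 n w * Z1 n w + I0 n w * Z3 n w) in
  let S4 (t : R) (w : T') :=
    \sum_(0 <= n < (N t w).+1) (I2 n w * Z2 n w + I0 n w * Z4 n w) in
  fdd_equal P (fun t w => (S1 t w, S2 t w)) P' (fun t w => (S3 t w, S4 t w)).
Proof.
move=> l0 l1 l2 pN0 pN1 pN2 claimsY indep S1 S2.
pose la := by_type lambda1 lambda2 lambda0.
have la0 a : 0 < la a by elim/ord3P: a; rewrite /la by_typeE.
have pN a : poisson_process P (la a) (by_type N1 N2 N0 a).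
  by elim/ord3P: a; rewrite /la !by_typeE.
have sumla : \sum_a la a = lambda1 + lambda2 + lambda0 by exact: sum_by_type.
have sumla0 : 0 < \sum_a la a by rewrite sumla !addr_gt0.
have SE t w : (S1 t w, S2 t w) =
    \sum_a \sum_(l < by_type N1 N2 N0 a t w) claim Y1 Y2 Y3 Y4 a l w.
  by apply: sum_claims; exact: (claim_sizes_0 claimsY).
have indS := superposition_independent claimsY pN indep.
have fddS d2 (T2 : measurableType d2) (P2 : probability T2 R) (X : R -> T2 -> R * R) :
    fdd_equal P (fun t w => \sum_a \sum_(l < by_type N1 N2 N0 a t w)
      claim Y1 Y2 Y3 Y4 a l w) P2 X ->
    fdd_equal P (fun t w => (S1 t w, S2 t w)) P2 X.
  by under [in X in _ -> X]eq2_fun do rewrite SE.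
split.
  (* On the given space: N0 with time rescaled to the total rate, the same
     claims, and the marks made from the cells of N1 and N2. *)
  have c0 : 0 < (\sum_a la a) / lambda0 by rewrite divr_gt0.
  have pN' := poisson_process_scale c0 pN0.
  rewrite divfK ?gt_eqF// in pN'.
  have ind' := increment_mark_independent claimsY la0 pN indep c0.
  have law' := increment_mark_law claimsY la0 pN indep.
  apply: (compound_poisson_marked pN' _ _ _ ind' _ sumla0).
  - exact: (measurable_increment_mark la0 pN).
  - by move=> m m' a; rewrite !law'.
  - exact: (measurable_claim claimsY).
  - by move=> a l l'; exact: (same_law_claim claimsY).
  apply: fddS.
  apply: (superposition_fdd_thinning la0 pN (measurable_claim claimsY) indS pN'
    _ law' (measurable_claim claimsY) ind').
  - exact: (measurable_increment_mark la0 pN).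
  - by move=> a l l'; exact: (same_law_claim claimsY).
move=> d' T' P' N Z1 Z2 Z3 Z4 I1 I2 I0 lambda pN' claimsZ law1 law2 law34.
move=> I00 iidI PI1 PI2 PI0 indep' S3 S4.
apply: fddS.
pose Im n w := (I1 n w, I2 n w, I0 n w).
pose C m w := mark (Im m.+1 w).
have [mI indI lawI] := iidI.
pose q a := la a / \sum_b la b.
have sumq : \sum_a q a = 1 by rewrite -mulr_suml divff// gt_eqF.
have lawIm m a : P' (Im m.+1 @^-1` [set unit_mark R a]) = (q a)%:E.
  have := lawI m [set unit_mark R a] (measurable_unit_mark a).
  rewrite -[X in P' X]/(Im m.+1 @^-1` _) => ->.
  elim/ord3P: a; rewrite /q /la by_typeE sumla -/lambda.
  - rewrite -PI1; congr (P' _); apply/seteqP; split => w;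
    by rewrite /unit_mark by_typeE /= => -[-> -> ->].
  - rewrite -PI2; congr (P' _); apply/seteqP; split => w;
    by rewrite /unit_mark by_typeE /= => -[-> -> ->].
  - rewrite -PI0; congr (P' _); apply/seteqP; split => w;
    by rewrite /unit_mark by_typeE /= => -[-> -> ->].
have mC m a : measurable (C m @^-1` [set a]).
  have := mI m measurableT _ (@measurable_mark_preimage R [set a]).
  by rewrite setTI.
have lawC m a : P' (C m @^-1` [set a]) = (q a)%:E.
  exact: (law_mark (mI m) sumq (lawIm m)).
have CI m : preimage_set_system setT (C m) setT `<=` sigma_rv (Im m.+1).
  move=> _ [B _ <-]; exists (@mark R @^-1` B) => //.
  exact: measurable_mark_preimage.
rewrite /lambda -sumla in pN'.
have ind' := thinning_independent claimsZ pN' indI CI indep'.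
have core := superposition_fdd_thinning la0 pN (measurable_claim claimsY) indS pN'
  mC lawC (measurable_claim claimsZ) ind'
  (same_law_claims claimsY claimsZ law1 law2 law34).
pose summand m w : R * R :=
  (I1 m.+1 w * Z1 m.+1 w + I0 m.+1 w * Z3 m.+1 w,
   I2 m.+1 w * Z2 m.+1 w + I0 m.+1 w * Z4 m.+1 w).
have S34E t w : (S3 t w, S4 t w) = \sum_(m < N t w) summand m w.
  have [I10 I20 I00'] := I00 w.
  rewrite [RHS]surjective_pairing sum_fst sum_snd /S3 /S4.
  by rewrite !big_nat_recl// I10 I20 I00' !mul0r !addr0 !add0r !big_mkord.
have msummand m : measurable_fun setT (summand m).
  have /measurable_fun_pairP[/measurable_fun_pairP[m1 m2] m0] := mI m.
  have [mZ1 _ _] := claim_sizes_iid1 claimsZ.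
  have [mZ2 _ _] := claim_sizes_iid2 claimsZ.
  have [mZ34 _ _] := claim_sizes_iid34 claimsZ.
  have /measurable_fun_pairP[mZ3 mZ4] := mZ34 m.
  apply: measurable_fun_pair; apply: measurable_funD; apply: measurable_funM => //.
(* Where the indicator vector is a unit vector, the summand is the claim of the
   type that it names. *)
have marks_ae : {ae P', forall w m, summand m w = claim Z1 Z2 Z3 Z4 (C m w) m w}.
  have := ae_foralln (fun m => ae_unit_mark (mI m) sumq (lawIm m)).
  apply: filterS => w Iw m; have := Iw m; rewrite -[mark _]/(C m w).
  elim/ord3P: (C m w); rewrite /unit_mark /claim by_typeE => -[E1 E2 E0];
  by rewrite /summand E1 E2 E0 by_typeE !mul1r !mul0r ?addr0 ?add0r.
move=> n t t0 B mB; rewrite (core n t t0 B mB).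
have mN i v : measurable (N (tnth t i) @^-1` [set v]).
  rewrite -[X in measurable X]setTI.
  exact: (poisson_process_measurable pN').
have mmarked m : measurable_fun setT (fun w => claim Z1 Z2 Z3 Z4 (C m w) m w).
  exact: (measurable_fun_fiberwise (mC m) (f := fun a w => claim Z1 Z2 Z3 Z4 a m w)
    (fun a => measurable_claim claimsZ a m)).
apply: ae_eq_probability.
- apply: measurable_tuple_event => // i.
  apply: (measurable_fun_fiberwise (mN i)
    (f := fun v w => \sum_(m < v) claim Z1 Z2 Z3 Z4 (C m w) m w)) => v.
  exact: measurable_sum_pair.
- apply: measurable_tuple_event => // i; under eq_fun do rewrite S34E.
  apply: (measurable_fun_fiberwise (mN i)
    (f := fun v w => \sum_(m < v) summand m w)) => v.
  exact: measurable_sum_pair.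
- apply: filterS marks_ae => w Ew; rewrite /preimage/=.
  suff -> : [tuple (S3 (tnth t i) w, S4 (tnth t i) w) | i < n] =
    [tuple \sum_(m < N (tnth t i) w) claim Z1 Z2 Z3 Z4 (C m w) m w | i < n] by [].
  apply: eq_from_tnth => i; rewrite !tnth_mktuple S34E.
  by apply: eq_bigr => m _; exact: Ew.
Qed.
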